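(* Let $p\in[0,1]$ be computable and let $r_p$ be a universal $p$-sparseness test. A sequence $\omega\in\Omega$ is $p$-sparse if and only if $r_p(\omega)<\infty$.
   Context: $\Omega=\{0,1\}^{\mathbb{N}}$; $B_p$ is the Bernoulli measure with parameter $p$. Coordinatewise order: $\omega\le\omega'$ if $\omega(i)\le\omega'(i)$ for all $i$. A sequence $\omega$ is $p$-sparse if $\omega\le\omega'$ for some $\omega'$ that is Martin-Löf random with respect to $B_p$ (equivalently, with a finite value of a universal expectation-bounded $B_p$-test). A function $f:\Omega\to[0,\infty]$ is monotone if $f(\omega)\le f(\omega')$ whenever $\omega\le\omega'$; it is lower semicomputable if each $\{\omega:r<f(\omega)\}$ ($r$ rational) is a union of an enumerable family of intervals $x\Omega$ (sequences with prefix $x$), uniformly in $r$. A $p$-sparseness test is a monotone lower semicomputable $f$ with $\int f\,dB_p\le1$; a universal one is a $p$-sparseness test dominating every $p$-sparseness test up to a multiplicative constant (one exists). *)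

(* Defs.v *)
From HB Require Import structures.
From mathcomp Require Import all_boot all_order all_algebra.
From mathcomp Require Import all_classical all_reals all_analysis.

Set Implicit Arguments.
Unset Strict Implicit.
Unset Printing Implicit Defensive.

Import Order.TTheory GRing.Theory Num.Theory.

Local Open Scope classical_set_scope.
Local Open Scope ring_scope.

(* Programs for the partial recursive functions. A program is run on a finite
   list of natural numbers, missing arguments being read as 0. *)
Inductive recfun : Type :=
| RZero
| RSucc
| RProj of nat
| RComp of recfun & seq recfun
| RPrec of recfun & recfun
| RMu of recfun.

(* [receval c v y]: program [c] halts on input [v] with output [y]. *)
Inductive receval : recfun -> seq nat -> nat -> Prop :=
| EZero v : receval RZero v 0
| ESucc v : receval RSucc v (nth 0%N v 0).+1
| EProj i v : receval (RProj i) v (nth 0%N v i)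
| EComp f gs v ws y :
    size ws = size gs ->
    (forall i, (i < size gs)%N -> receval (nth RZero gs i) v (nth 0%N ws i)) ->
    receval f ws y ->
    receval (RComp f gs) v y
| EPrec0 f g v y :
    receval f v y ->
    receval (RPrec f g) (0%N :: v) y
| EPrecS f g n v z y :
    receval (RPrec f g) (n :: v) z ->
    receval g [:: n, z & v] y ->
    receval (RPrec f g) (n.+1 :: v) y
| EMu f n v (k : nat -> nat) :
    (forall m, (m < n)%N -> receval f (m :: v) (k m).+1) ->
    receval f (n :: v) 0 ->
    receval (RMu f) v n.

Definition total_recursive (F : nat -> nat) : Prop :=
  exists c, forall n, receval c [:: n] (F n).

(* Sign bit, absolute numerator and denominator, in lowest terms. *)
Definition rat_code (q : rat) : seq nat :=
  [:: nat_of_bool (q < 0); `|numq q|%N; `|denq q|%N].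

(* The number whose binary expansion is a leading 1 followed by [x]. *)
Definition string_code (x : seq bool) : nat :=
  foldl (fun (n : nat) (b : bool) => (n.*2 + b)%N) 1%N x.

Definition computable_rat_seq (q : nat -> rat) : Prop :=
  forall i, (i < 3)%N -> total_recursive (fun n => nth 0%N (rat_code (q n)) i).

Definition computable_real (R : realType) (p : R) : Prop :=
  exists2 q : nat -> rat, computable_rat_seq q
    & forall n, `|p - ratr (q n)| <= 2 ^- n.

(* The interval x Omega of the sequences with prefix [x]. *)
Definition prefix_interval (x : seq bool) : set (nat -> bool) :=
  [set w | mkseq w (size x) = x].

(* Infinite binary sequences with the sigma-algebra generated by intervals. *)
Definition Omega := g_sigma_algebraType (range prefix_interval).

Definition omega_le (w w' : Omega) : Prop := forall i, (w i <= w' i)%N.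

(* The strings listed by [c] with parameters [v]: the program is run on
   n :: v for n = 0, 1, 2, ..., and outputs that code no string, as well as
   inputs on which it diverges, are ignored. *)
Definition enumerated (c : recfun) (v : seq nat) : set (seq bool) :=
  [set x | exists n, receval c (n :: v) (string_code x)].

Definition enum_open (c : recfun) (v : seq nat) : set Omega :=
  \bigcup_(x in enumerated c v) prefix_interval x.

Definition lower_semicomputable (R : realType) (f : Omega -> \bar R) : Prop :=
  exists c, forall q : rat,
    [set w | ((ratr q)%:E < f w)%E] = enum_open c (rat_code q).

Definition omega_monotone (R : realType) (f : Omega -> \bar R) : Prop :=
  forall w w', omega_le w w' -> (f w <= f w')%E.

(* These values on intervals determine the measure uniquely. *)
Definition is_bernoulli_measure (R : realType) (p : R)
    (B : probability Omega R) : Prop :=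
  forall x : seq bool, B (prefix_interval x) = (\prod_(b <- x) bernoulli_pmf p b)%:E.

Definition martin_lof_test (R : realType) (B : probability Omega R)
    (U : nat -> set Omega) : Prop :=
  (exists c, forall n, U n = enum_open c [:: n]) /\
  (forall n, (B (U n) <= (2 ^- n)%:E)%E).

Definition martin_lof_random (R : realType) (B : probability Omega R)
    (w : Omega) : Prop :=
  forall U, martin_lof_test B U -> ~ (\bigcap_n U n) w.

Definition sparse (R : realType) (B : probability Omega R) (w : Omega) : Prop :=
  exists2 w', omega_le w w' & martin_lof_random B w'.

Definition sparseness_test (R : realType) (B : probability Omega R)
    (f : Omega -> \bar R) : Prop :=
  [/\ (forall w, 0 <= f w)%E, omega_monotone f, lower_semicomputable f
    & (\int[B]_w f w <= 1)%E].

Definition universal_sparseness_test (R : realType) (B : probability Omega R)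
    (r : Omega -> \bar R) : Prop :=
  sparseness_test B r /\
  forall f, sparseness_test B f ->
    exists2 C : R, 0 < C & forall w, (f w <= C%:E * r w)%E.

(* Main.v *)
(* If [w <= w'] with [w'] random, then the sets [r > 2 ^ n] form a Martin-Loef
   test by Markov's inequality, so [r w <= r w'] is finite.

   Conversely, a universal machine enumerates all enumerable open sets;
   discarding what cannot be certified to have small measure yields uniformly
   enumerable open sets V_m with B (V_m) <= 2 ^- m such that each V_m contains
   every non-random sequence. Let W_m be the set of the sequences all of whose
   majorants lie in V_(2m). It is upward closed, is contained in V_(2m), and by
   compactness is enumerable uniformly in m. Hence sup_m m * 1_(W_m) is a
   sparseness test, finite wherever [r] is. Where it is finite at [w], some W_m
   misses [w]: some majorant of [w] lies outside V_(2m), hence is random. *)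
Require Import Defs.
From HB Require Import structures.
From mathcomp Require Import all_boot all_order all_algebra.
From mathcomp Require Import all_classical all_reals all_analysis.
From mathcomp Require Import measurable_realfun zify ring lra.

Set Implicit Arguments.
Unset Strict Implicit.
Unset Printing Implicit Defensive.

Import Order.TTheory GRing.Theory Num.Theory.
Import numFieldNormedType.Exports.

Local Open Scope classical_set_scope.
Local Open Scope ring_scope.
Local Open Scope nat_scope.

(** * Total recursive functions *)

(** Tests are given by programs, so treating all of them at once needs a machine that runs a coded
    program for a prescribed number of steps and is itself total recursive. With 0 as a dummy
    output, partial enumerations become total functions; from there on strings are numbers, and
    every test made on them is arithmetic with bounded quantifiers. The main obstacle is that [p] is
    known only approximately, so a bound of the form B <= 2^-n cannot be verified in finite time. A
    strict bound can be confirmed by upper approximations. Therefore a stage is compared with 2 *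
    2^-n: whatever has measure at most 2^-n is confirmed eventually, and whatever is confirmed has
    measure at most twice that. This factor and the summation over all programs are paid for by
    using program [e] at level m + e + 2. *)

Lemma receval_compE f gs v y : receval (RComp f gs) v y ->
  exists ws, [/\ size ws = size gs,
    (forall i, i < size gs -> receval (nth RZero gs i) v (nth 0 ws i))
    & receval f ws y].
Proof. by move=> H; inversion H; subst; exists ws. Qed.

Lemma receval_precE f g n v y : receval (RPrec f g) (n.+1 :: v) y ->
  exists2 z, receval (RPrec f g) (n :: v) z & receval g [:: n, z & v] y.
Proof. by move=> H; inversion H; subst; exists z. Qed.

Lemma receval_muE f v y : receval (RMu f) v y ->
  (forall m, m < y -> exists k, receval f (m :: v) k.+1) /\
  receval f (y :: v) 0.
Proof.
by move=> H; inversion H as [| | | | | |f' n v' k Hk H0]; subst;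
  split=> // m lt; exists (k m); exact: Hk.
Qed.

Lemma receval_inj c v y y' : receval c v y -> receval c v y' -> y = y'.
Proof.
move=> H; elim: H y' => {c v y}.
- by move=> v y' H; inversion H.
- by move=> v y' H; inversion H.
- by move=> i v y' H; inversion H.
- move=> f gs v ws y szw _ IHg _ IHf y' /receval_compE[ws' [szw' Hg Hf]].
  apply: IHf; suff -> : ws = ws' by [].
  apply: (@eq_from_nth _ 0); first by rewrite szw.
  by move=> i; rewrite szw => ltig; apply: IHg => //; apply: Hg.
- by move=> f g v y _ IH y' H; inversion H; subst; exact: IH.
- move=> f g n v z y _ IHz _ IHg y' /receval_precE[z' /IHz <-].
  exact: IHg.
- move=> f n v k _ IHk _ IH0 y' /receval_muE[Hk H0].
  (* If two outputs differ, the smaller one is a zero of [f] at which the other search has recorded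
     a positive value. *)
  case: (ltngtP n y') => // lt.
    by have [? /IH0] := Hk _ lt.
  by have := IHk _ lt _ H0.
Qed.

Lemma receval_comp1 f g1 v a y :
  receval g1 v a -> receval f [:: a] y -> receval (RComp f [:: g1]) v y.
Proof.
by move=> H1 H; apply: (@EComp f [:: g1] v [:: a]) => // -[|//].
Qed.

Lemma receval_comp2 f g1 g2 v a b y :
  receval g1 v a -> receval g2 v b -> receval f [:: a; b] y ->
  receval (RComp f [:: g1; g2]) v y.
Proof.
by move=> H1 H2 H; apply: (@EComp f [:: g1; g2] v [:: a; b]) => // -[|[|//]].
Qed.

Lemma receval_comp3 f g1 g2 g3 v a b c y :
  receval g1 v a -> receval g2 v b -> receval g3 v c ->
  receval f [:: a; b; c] y -> receval (RComp f [:: g1; g2; g3]) v y.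
Proof.
move=> H1 H2 H3 H.
by apply: (@EComp f [:: g1; g2; g3] v [:: a; b; c]) => // -[|[|[|//]]].
Qed.

Lemma receval_prec f g v (F : nat -> nat) :
  receval f v (F 0) -> (forall n, receval g [:: n, F n & v] (F n.+1)) ->
  forall n, receval (RPrec f g) (n :: v) (F n).
Proof.
move=> H0 HS; elim=> [|n IH]; first exact: EPrec0.
exact: EPrecS IH (HS n).
Qed.

Definition radd := RPrec (RProj 0) (RComp RSucc [:: RProj 1]).
Definition rdouble := RComp radd [:: RProj 0; RProj 0].
Definition rpair := RPrec (RComp RSucc [:: rdouble]) (RComp rdouble [:: RProj 1]).
Definition rnot := RPrec (RComp RSucc [:: RZero]) RZero.
Definition rodd := RPrec RZero (RComp rnot [:: RProj 1]).
Definition rhalf := RPrec RZero (RComp radd [:: RComp rodd [:: RProj 0]; RProj 1]).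
(** Recursion used as a case split: the base sees the list x, y and the step sees n, z, x, y, so the
    projections select [y] and [x]. *)
Definition rif := RPrec (RProj 1) (RProj 2).

Lemma receval_add a b : receval radd [:: a; b] (a + b).
Proof.
move: a; apply: (@receval_prec _ _ _ (addn^~ b)); first exact: EProj.
by move=> n; apply: receval_comp1; [exact: EProj|exact: ESucc].
Qed.

Lemma receval_double a v : receval rdouble (a :: v) a.*2.
Proof.
rewrite -addnn; apply: receval_comp2; [exact: EProj|exact: EProj|].
exact: receval_add.
Qed.

(* [npair] is a bijection from pairs to positive numbers, with projections [nhd]
   (the 2-adic valuation) and [ntl]; lists are coded as iterated pairs ending in 0. *)
Definition npair a b := 2 ^ a * b.*2.+1.

Lemma receval_pair a b : receval rpair [:: a; b] (npair a b).
Proof.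
move: a; apply: (@receval_prec _ _ _ (npair^~ b)).
  rewrite /npair expn0 mul1n; apply: receval_comp1 (ESucc _).
  exact: receval_double.
move=> n; rewrite /npair expnS -mulnA mul2n.
apply: receval_comp1; [exact: EProj|exact: receval_double].
Qed.

Lemma receval_not a v : receval rnot (a :: v) (a == 0).
Proof.
move: a; apply: (@receval_prec _ _ _ (fun a => nat_of_bool (a == 0))).
  by apply: receval_comp1; [exact: EZero|exact: ESucc].
by move=> n; exact: EZero.
Qed.

Lemma receval_odd a v : receval rodd (a :: v) (odd a).
Proof.
move: a; apply: (@receval_prec _ _ _ (fun a => nat_of_bool (odd a))).
  exact: EZero.
move=> n; apply: receval_comp1; first exact: EProj.
by move=> /=; have := receval_not (odd n) [::]; case: (odd n).
Qed.

Lemma receval_half a v : receval rhalf (a :: v) a./2.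
Proof.
move: a; apply: (@receval_prec _ _ _ half); first exact: EZero.
move=> n; rewrite -[n.+1./2]/(uphalf n) uphalf_half.
apply: receval_comp2; [|exact: EProj|exact: receval_add].
by apply: receval_comp1; [exact: EProj|exact: receval_odd].
Qed.

Lemma receval_if b x y : receval rif [:: b; x; y] (if b != 0 then x else y).
Proof.
move: b; apply: (@receval_prec _ _ _ (fun b => if b != 0 then x else y)).
  exact: EProj.
by move=> n; exact: EProj.
Qed.

(** Odd numbers are fixed points, and the exponent of 2 in [npair a b] is smaller than the number
    itself. So [z] rounds always reach the odd part, and both projections are primitive recursive,
    without a search. *)
Definition strip2 z := if odd z then z else z./2.

Definition nhd z := \sum_(i < z) ~~ odd (iter i strip2 z).
Definition ntl z := (iter z strip2 z)./2.

Lemma strip2_iter a b i :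
  iter i strip2 (npair a b) = npair (a - i) b.
Proof.
elim: i => [|i IH]; first by rewrite subn0.
rewrite iterS IH subnS /strip2 /npair.
case: (a - i) => [|d]; first by rewrite expn0 mul1n oddS odd_double.
by rewrite expnS -mulnA mul2n odd_double doubleK.
Qed.

Lemma odd_npair a b : odd (npair a b) = (a == 0).
Proof. by rewrite /npair oddM oddX /= odd_double andbT orbF. Qed.

Lemma npair_gt a b : a < npair a b.
Proof. by apply: (leq_trans (ltn_expl a (ltnSn 1))); rewrite leq_pmulr. Qed.

Lemma npair_neq0 a b : (npair a b == 0) = false.
Proof. by apply/negbTE; rewrite -lt0n (leq_trans _ (npair_gt a b)). Qed.

Lemma nhdK a b : nhd (npair a b) = a.
Proof.
rewrite /nhd; under eq_bigr do rewrite strip2_iter odd_npair subn_eq0 -ltnNge.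
have sum_lt n : \sum_(i < n) (i < a) = minn n a.
  by elim: n => [|n IH]; rewrite ?big_ord0 ?min0n // big_ord_recr /= IH; lia.
by rewrite sum_lt; apply/minn_idPr/ltnW/npair_gt.
Qed.

Lemma ntlK a b : ntl (npair a b) = b.
Proof.
rewrite /ntl strip2_iter; have /eqP-> : a - npair a b == 0.
  by rewrite subn_eq0 ltnW // npair_gt.
by rewrite /npair mul1n /= uphalf_double.
Qed.

(** The head of the coded empty list is 0, in agreement with missing arguments being read as 0. *)
Lemma nhd0 : nhd 0 = 0. Proof. by rewrite /nhd big_ord0. Qed.

Definition rstrip := RComp rif [:: rodd; RProj 0; rhalf].
Definition riter_strip := RPrec (RProj 0) (RComp rstrip [:: RProj 1]).
Definition rtl := RComp rhalf [:: RComp riter_strip [:: RProj 0; RProj 0]].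
Definition rhd :=
  RComp (RPrec RZero (RComp radd [:: RProj 1; RComp rnot
    [:: RComp rodd [:: RComp riter_strip [:: RProj 0; RProj 2]]]]))
  [:: RProj 0; RProj 0].

Lemma receval_iter_strip i z v :
  receval riter_strip (i :: z :: v) (iter i strip2 z).
Proof.
move: i; apply: (@receval_prec _ _ _ (fun i => iter i strip2 z)).
  exact: EProj.
move=> n; apply: receval_comp1; first exact: EProj.
apply: receval_comp3; [exact: receval_odd|exact: EProj|exact: receval_half|].
rewrite iterS /strip2 /=.
by case: ifP => _; [exact: (receval_if 1)|exact: (receval_if 0)].
Qed.

Lemma receval_tl z v : receval rtl (z :: v) (ntl z).
Proof.
apply: receval_comp1; last exact: receval_half.
apply: receval_comp2; [exact: EProj|exact: EProj|exact: receval_iter_strip].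
Qed.

Lemma receval_hd z v : receval rhd (z :: v) (nhd z).
Proof.
apply: receval_comp2; [exact: EProj|exact: EProj|].
apply: (@receval_prec _ _ _ (fun n => \sum_(i < n) ~~ odd (iter i strip2 z))).
  by rewrite big_ord0; exact: EZero.
move=> n; rewrite big_ord_recr /=.
apply: receval_comp2; [exact: EProj| |exact: receval_add] => /=.
apply: receval_comp1.
  apply: receval_comp1; last exact: receval_odd.
  by apply: receval_comp2; [exact: EProj|exact: EProj|exact: receval_iter_strip].
by move=> /=; have := receval_not (odd (iter n strip2 z)) [::]; case: (odd _).
Qed.

(** * Closure properties of total recursive functions *)

Lemma tr_ext f g : f =1 g -> total_recursive f -> total_recursive g.
Proof. by move=> /funext->. Qed.

Lemma tr_comp f g : total_recursive f -> total_recursive g ->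
  total_recursive (fun x => f (g x)).
Proof.
move=> [cf Hf] [cg Hg]; exists (RComp cf [:: cg]) => n.
exact: receval_comp1 (Hg n) (Hf _).
Qed.

Lemma tr_id : total_recursive (fun x => x).
Proof. by exists (RProj 0) => n; exact: EProj. Qed.

Lemma tr_succ a : total_recursive a -> total_recursive (fun x => (a x).+1).
Proof. by apply: (@tr_comp succn); exists RSucc => n; exact: ESucc. Qed.

Lemma tr_const n : total_recursive (fun=> n).
Proof.
elim: n => [|n IH]; last exact: tr_succ.
by exists RZero => n; exact: EZero.
Qed.

Section Closure.
Variables (a b : nat -> nat).
Hypotheses (ha : total_recursive a) (hb : total_recursive b).

Lemma tr_hd : total_recursive (fun x => nhd (a x)).
Proof. by apply: tr_comp => //; exists rhd => n; exact: receval_hd. Qed.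

Lemma tr_tl : total_recursive (fun x => ntl (a x)).
Proof. by apply: tr_comp => //; exists rtl => n; exact: receval_tl. Qed.

Lemma tr_half : total_recursive (fun x => (a x)./2).
Proof. by apply: tr_comp => //; exists rhalf => n; exact: receval_half. Qed.

Lemma tr_odd : total_recursive (fun x => odd (a x)).
Proof.
apply: (@tr_comp (fun n => nat_of_bool (odd n))) => //.
by exists rodd => n; exact: receval_odd.
Qed.

Lemma tr_pair : total_recursive (fun x => npair (a x) (b x)).
Proof.
case: ha hb => [ca Ha] [cb Hb]; exists (RComp rpair [:: ca; cb]) => n.
exact: receval_comp2 (Ha n) (Hb n) (receval_pair _ _).
Qed.

Lemma tr_add : total_recursive (fun x => a x + b x).
Proof.
case: ha hb => [ca Ha] [cb Hb]; exists (RComp radd [:: ca; cb]) => n.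
exact: receval_comp2 (Ha n) (Hb n) (receval_add _ _).
Qed.

Lemma tr_if (P : nat -> bool) :
  total_recursive (fun x => P x) ->
  total_recursive (fun x => if P x then a x else b x).
Proof.
move=> [cp Hp]; case: ha hb => [ca Ha] [cb Hb].
exists (RComp rif [:: cp; ca; cb]) => n.
apply: receval_comp3 (Hp n) (Ha n) (Hb n) _.
by case: (P n); [exact: (receval_if 1)|exact: (receval_if 0)].
Qed.

(** As [total_recursive] is about unary functions, the step is supplied on the packed triple of
    counter, previous value and parameter. *)
Lemma tr_rec (s : nat -> nat -> nat -> nat) :
  total_recursive (fun z => s (nhd z) (nhd (ntl z)) (ntl (ntl z))) ->
  total_recursive
    (fun x => nat_rect (fun=> nat) (b x) (fun i r => s i r x) (a x)).
Proof.
move=> [cs Hs]; case: ha hb => [ca Ha] [cb Hb].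
exists (RComp (RPrec cb (RComp cs
  [:: RComp rpair [:: RProj 0; RComp rpair [:: RProj 1; RProj 2]]]))
  [:: ca; RProj 0]) => n.
apply: receval_comp2 (Ha n) (EProj _ _) _ => /=.
move: (a n); apply: (@receval_prec _ _ _
  (fun k => nat_rect (fun=> nat) (b n) (fun i r => s i r n) k)) => //= k.
set r := nat_rect _ _ _ _.
apply: (@receval_comp1 _ _ _ (npair k (npair r n))).
  apply: receval_comp2; [exact: EProj| |exact: receval_pair].
  apply: receval_comp2; [exact: EProj|exact: EProj|exact: receval_pair].
by have := Hs (npair k (npair r n)); rewrite !(nhdK, ntlK).
Qed.
End Closure.

Definition bexn (n : nat) (P : nat -> bool) := has P (iota 0 n).
Definition balln (n : nat) (P : nat -> bool) := all P (iota 0 n).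

Definition bsum (n : nat) (f : nat -> nat) := \sum_(i < n) f i.

Lemma bexnP n (P : nat -> bool) : reflect (exists2 i, i < n & P i) (bexn n P).
Proof.
apply: (iffP hasP) => -[i]; first by rewrite mem_iota; exists i.
by exists i => //; rewrite mem_iota.
Qed.

Lemma ballnP n (P : nat -> bool) : reflect (forall i, i < n -> P i) (balln n P).
Proof.
apply: (iffP allP) => H i; first by move=> lt; apply: H; rewrite mem_iota.
by rewrite mem_iota => lt; apply: H.
Qed.

Lemma bexnS n P : bexn n.+1 P = bexn n P || P n.
Proof. by rewrite /bexn -addn1 iotaD has_cat /= orbF. Qed.

Section Arithmetic.
Variables (a b : nat -> nat).
Hypotheses (ha : total_recursive a) (hb : total_recursive b).

Lemma tr_mul : total_recursive (fun x => a x * b x).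
Proof.
apply: (@tr_ext (fun x =>
  nat_rect (fun=> nat) 0 (fun i r => b x + r) (a x))).
  by move=> x /=; elim: (a x) => //= n ->; rewrite mulSn.
apply: (@tr_rec _ (fun=> 0) _ _ (fun i r x => b x + r)) => //.
  exact: tr_const.
apply: tr_add; first by apply: tr_comp => //; do 2!apply: tr_tl; exact: tr_id.
by apply: tr_hd; apply: tr_tl; exact: tr_id.
Qed.

Lemma tr_sub : total_recursive (fun x => a x - b x).
Proof.
apply: (@tr_ext (fun x =>
  nat_rect (fun=> nat) (a x) (fun i r => r.-1) (b x))).
  by move=> x /=; elim: (b x) => /= [|n ->]; rewrite ?subn0 ?subnS.
apply: (@tr_rec b a _ _ (fun i r x => r.-1)) => //.
apply: (@tr_comp predn); last by apply: tr_hd; apply: tr_tl; exact: tr_id.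
apply: (@tr_ext (fun x => nat_rect (fun=> nat) 0 (fun i _ => i) x)).
  by case.
apply: (@tr_rec (fun x => x) (fun=> 0) _ _ (fun i r x => i)).
- exact: tr_id.
- exact: tr_const.
- by apply: tr_hd; exact: tr_id.
Qed.

End Arithmetic.

Section Boolean.
Variables (P Q : nat -> bool).
Hypotheses (hP : total_recursive (fun x => P x))
  (hQ : total_recursive (fun x => Q x)).

Lemma tr_and : total_recursive (fun x => P x && Q x).
Proof.
apply: (@tr_ext (fun x => P x * Q x)); last exact: tr_mul.
by move=> x; rewrite mulnb.
Qed.

Lemma tr_not : total_recursive (fun x => ~~ P x).
Proof.
apply: (@tr_ext (fun x => 1 - P x)); last by apply: tr_sub => //; exact: tr_const.
by move=> x; case: (P x).
Qed.

Lemma tr_or : total_recursive (fun x => P x || Q x).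
Proof.
apply: (@tr_ext (fun x => if P x then 1 else Q x)).
  by move=> x; case: (P x).
by apply: tr_if => //; exact: tr_const.
Qed.
End Boolean.

Section Comparison.
Variables (a b : nat -> nat).
Hypotheses (ha : total_recursive a) (hb : total_recursive b).

Lemma tr_leq : total_recursive (fun x => a x <= b x).
Proof.
apply: (@tr_ext (fun x => 1 - (a x - b x))).
  by move=> x; rewrite /leq; case: (a x - b x) => // n; rewrite subSS sub0n.
by apply: tr_sub; [exact: tr_const|exact: tr_sub].
Qed.

Lemma tr_eq : total_recursive (fun x => a x == b x).
Proof.
apply: (@tr_ext (fun x => 1 - (a x - b x + (b x - a x)))).
  move=> x; rewrite -[_ == _]/(eqn _ _); case: eqnP => h; lia.
apply: tr_sub; first exact: tr_const.
by apply: tr_add; apply: tr_sub.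
Qed.

End Comparison.

Lemma tr_exp a b : total_recursive a -> total_recursive b ->
  total_recursive (fun x => a x ^ b x).
Proof.
move=> ha hb; apply: (@tr_ext (fun x =>
  nat_rect (fun=> nat) 1 (fun i r => a x * r) (b x))).
  by move=> x /=; elim: (b x) => //= n ->; rewrite expnS.
apply: (@tr_rec _ (fun=> 1) _ _ (fun i r x => a x * r)) => //.
  exact: tr_const.
apply: tr_mul; first by apply: tr_comp => //; do 2!apply: tr_tl; exact: tr_id.
by apply: tr_hd; apply: tr_tl; exact: tr_id.
Qed.

Lemma tr_iter n b (f : nat -> nat -> nat) :
  total_recursive n -> total_recursive b ->
  total_recursive (fun z => f (ntl z) (nhd z)) ->
  total_recursive (fun x => iter (n x) (f x) (b x)).
Proof.
move=> hn hb hf; apply: (@tr_ext (fun x =>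
  nat_rect (fun=> nat) (b x) (fun i r => f x r) (n x))).
  by move=> x; elim: (n x) => //= i ->.
apply: (@tr_rec n b _ _ (fun i r x => f x r)) => //.
apply: (@tr_ext (fun z => f (ntl (ntl z)) (nhd (ntl z)))) => //.
by apply: (tr_comp hf); apply: tr_tl; exact: tr_id.
Qed.

Lemma tr_bexn n (P : nat -> nat -> bool) : total_recursive n ->
  total_recursive (fun z => P (ntl z) (nhd z)) ->
  total_recursive (fun x => bexn (n x) (P x)).
Proof.
move=> hn hP; apply: (@tr_ext (fun x =>
  nat_rect (fun=> nat) 0 (fun i r => if P x i then 1 else r) (n x))).
  move=> x; elim: (n x) => //= i ->; rewrite bexnS.
  by case: (P x i); rewrite ?orbT ?orbF.
apply: (@tr_rec _ (fun=> 0) _ _ (fun i r x => if P x i then 1 else r)) => //.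
  exact: tr_const.
apply: tr_if; [exact: tr_const|by apply: tr_hd; apply: tr_tl; exact: tr_id|].
have h : total_recursive (fun z => npair (nhd z) (ntl (ntl z))).
  by apply: tr_pair; [|apply: tr_tl]; [apply: tr_hd|apply: tr_tl]; exact: tr_id.
by apply: tr_ext (tr_comp hP h) => z /=; rewrite nhdK ntlK.
Qed.

Lemma tr_balln n (P : nat -> nat -> bool) : total_recursive n ->
  total_recursive (fun z => P (ntl z) (nhd z)) ->
  total_recursive (fun x => balln (n x) (P x)).
Proof.
move=> hn hP; apply: (@tr_ext (fun x => ~~ bexn (n x) (fun i => ~~ P x i))).
  move=> x; rewrite /balln /bexn -all_predC; congr nat_of_bool.
  by apply: eq_all => i /=; rewrite negbK.
by apply: tr_not; apply: (@tr_bexn n (fun x i => ~~ P x i)) => //; exact: tr_not.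
Qed.

Lemma tr_sum n (f : nat -> nat -> nat) : total_recursive n ->
  total_recursive (fun z => f (ntl z) (nhd z)) ->
  total_recursive (fun x => bsum (n x) (f x)).
Proof.
move=> hn hf; apply: (@tr_ext (fun x =>
  nat_rect (fun=> nat) 0 (fun i r => r + f x i) (n x))).
  move=> x; rewrite /bsum.
  by elim: (n x) => [|i /= ->]; rewrite ?big_ord0 // big_ord_recr.
apply: (@tr_rec _ (fun=> 0) _ _ (fun i r x => r + f x i)) => //.
  exact: tr_const.
apply: tr_add; first by apply: tr_hd; apply: tr_tl; exact: tr_id.
have h : total_recursive (fun z => npair (nhd z) (ntl (ntl z))).
  by apply: tr_pair; [|apply: tr_tl]; [apply: tr_hd|apply: tr_tl]; exact: tr_id.
by apply: tr_ext (tr_comp hf h) => z /=; rewrite nhdK ntlK.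
Qed.

Definition tr2 (f : nat -> nat -> nat) :=
  total_recursive (fun x => f (nhd x) (ntl x)).
Definition tr3 (f : nat -> nat -> nat -> nat) :=
  tr2 (fun x y => f x (nhd y) (ntl y)).
Definition tr4 (f : nat -> nat -> nat -> nat -> nat) :=
  tr3 (fun x y z => f x y (nhd z) (ntl z)).

Lemma tr_comp2 f a b : tr2 f -> total_recursive a -> total_recursive b ->
  total_recursive (fun x => f (a x) (b x)).
Proof.
move=> hf ha hb; apply: tr_ext (tr_comp hf (tr_pair ha hb)) => x /=.
by rewrite nhdK ntlK.
Qed.

Lemma tr_comp3 f a b c : tr3 f -> total_recursive a -> total_recursive b ->
  total_recursive c -> total_recursive (fun x => f (a x) (b x) (c x)).
Proof.
move=> hf ha hb hc.
apply: tr_ext (@tr_comp2 (fun x y => f x (nhd y) (ntl y)) _ _ hf ha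
  (tr_pair hb hc)) => x /=.
  by rewrite nhdK ntlK.
Qed.

Ltac tr_step :=
  lazymatch goal with
  | |- tr4 _ => rewrite /tr4
  | |- tr3 _ => rewrite /tr3
  | |- tr2 _ => rewrite /tr2
  | |- total_recursive nhd => exact: (tr_hd tr_id)
  | |- total_recursive ntl => exact: (tr_tl tr_id)
  | |- total_recursive half => exact: (tr_half tr_id)
  | |- total_recursive (fun x => x) => exact: tr_id
  | |- total_recursive (fun x => (@?a x).+1) => apply: (@tr_succ a)
  | |- total_recursive (fun x => nhd (@?a x)) => apply: (@tr_hd a)
  | |- total_recursive (fun x => ntl (@?a x)) => apply: (@tr_tl a)
  | |- total_recursive (fun x => half (@?a x)) => apply: (@tr_half a)
  | |- total_recursive (fun x => npair (@?a x) (@?b x)) => apply: (@tr_pair a b)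
  | |- total_recursive (fun x => @?a x + @?b x) => apply: (@tr_add a b)
  | |- total_recursive (fun x => @?a x * @?b x) => apply: (@tr_mul a b)
  | |- total_recursive (fun x => @?a x - @?b x) => apply: (@tr_sub a b)
  | |- total_recursive (fun x => @?a x ^ @?b x) => apply: (@tr_exp a b)
  | |- total_recursive (fun x => if _ then _ else _) => apply: tr_if
  | |- total_recursive (fun x => nat_of_bool (@?p x && @?q x)) =>
      apply: (@tr_and p q)
  | |- total_recursive (fun x => nat_of_bool (@?p x || @?q x)) =>
      apply: (@tr_or p q)
  | |- total_recursive (fun x => nat_of_bool (~~ @?p x)) => apply: (@tr_not p)
  | |- total_recursive (fun x => nat_of_bool (@?a x == @?b x)) =>
      apply: (@tr_eq a b)
  | |- total_recursive (fun x => nat_of_bool (@?a x <= @?b x)) =>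
      apply: (@tr_leq a b)
  | |- total_recursive (fun x => nat_of_bool (odd (@?a x))) => apply: (@tr_odd a)
  | |- total_recursive (fun x => iter (@?n x) (@?f x) (@?b x)) =>
      apply: (@tr_iter n b f)
  | |- total_recursive (fun x => nat_of_bool (bexn (@?n x) (@?f x))) =>
      apply: (@tr_bexn n f)
  | |- total_recursive (fun x => nat_of_bool (balln (@?n x) (@?f x))) =>
      apply: (@tr_balln n f)
  | |- total_recursive (fun x => bsum (@?n x) (@?f x)) =>
      apply: (@tr_sum n f)
  | |- total_recursive (fun x => _) => exact: tr_const
  end; cbv beta.
Ltac tr := repeat tr_step.

(** * A universal machine *)

Opaque npair nhd ntl.

Notation enc_seq := (foldr npair 0).

(* The arguments of a composition are coded in reverse order: they are evaluated
   from the last one to the first, each value being pushed on a list. *)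
Fixpoint rcode (c : recfun) : nat :=
  match c with
  | RZero => npair 1 0
  | RSucc => npair 2 0
  | RProj i => npair 3 i
  | RComp f gs =>
      npair 4 (npair (rcode f) (foldl (fun s g => npair (rcode g) s) 0 gs))
  | RPrec f g => npair 5 (npair (rcode f) (rcode g))
  | RMu f => npair 6 (rcode f)
  end.

Definition rcodes (gs : seq recfun) :=
  foldl (fun s g => npair (rcode g) s) 0 gs.

(* A machine state consists of a control word, an argument list and a stack of
   frames. Control words are the codes of programs (tags 1 to 6), returned values
   (tag 0), and compositions with partially evaluated arguments (tag 7). *)
Definition mstate c v k := npair c (npair v k).
Definition mret y k := mstate (npair 0 y) 0 k.
Definition margs f gs ws := npair 7 (npair f (npair gs ws)).
Definition fargs v f gs ws := npair 7 (npair v (npair f (npair gs ws))).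
Definition fprec g n v := npair 5 (npair g (npair n v)).
Definition fmu f n v := npair 6 (npair f (npair n v)).

Definition mreturn d fr k :=
  let e := ntl fr in let x := nhd (ntl e) in let z := ntl (ntl e) in
  if nhd fr == 7 then mstate (margs x (nhd z) (npair d (ntl z))) (nhd e) k
  else if nhd fr == 5 then mstate (nhd e) (npair x (npair d z)) k
  else if d == 0 then mret x k
  else mstate (nhd e) (npair x.+1 z) (npair (fmu (nhd e) x.+1 z) k).

(** The machine stays put in two situations: in a final state, so that surplus steps do not change
    the answer, and on a primitive recursion with empty argument list, for which [receval] has no
    rule. *)
Definition mstep s :=
  let c := nhd s in let v := nhd (ntl s) in let k := ntl (ntl s) in
  let t := nhd c in let d := ntl c in
  if t == 0 then if k == 0 then s else mreturn d (nhd k) (ntl k)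
  else if t == 1 then mret 0 k
  else if t == 2 then mret (nhd v).+1 k
  else if t == 3 then mret (nhd (iter d ntl v)) k
  else if t == 4 then mstate (margs (nhd d) (ntl d) 0) v k
  else if t == 5 then
    if v == 0 then s
    else if nhd v == 0 then mstate (nhd d) (ntl v) k
    else let n := nhd v - 1 in
      mstate c (npair n (ntl v)) (npair (fprec (ntl d) n (ntl v)) k)
  else if t == 6 then mstate d (npair 0 v) (npair (fmu d 0 v) k)
  else let gs := nhd (ntl d) in
    if gs == 0 then mstate (nhd d) (ntl (ntl d)) k
    else mstate (nhd gs) v (npair (fargs v (nhd d) (ntl gs) (ntl (ntl d))) k).

Lemma tr_mstep : total_recursive mstep.
Proof.
rewrite /mstep /mreturn /mret /mstate /margs /fmu /fargs /fprec; cbv zeta; tr.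
Qed.

Lemma nth_enc_seq i v : nhd (iter i ntl (enc_seq v)) = nth 0 v i.
Proof.
elim: i v => [|i IH] [|x v]; rewrite ?nth_nil.
- exact: nhd0.
- exact: nhdK.
- by rewrite iter_fix ?nhd0.
- by rewrite iterSr /= ntlK IH.
Qed.

Lemma rcodes_rcons gs g : rcodes (rcons gs g) = npair (rcode g) (rcodes gs).
Proof. by rewrite /rcodes foldl_rcons. Qed.

Definition npairE := (nhdK, ntlK, npair_neq0).

Section Step.
Variables (v k : nat).

Lemma mstep_zero : mstep (mstate (rcode RZero) v k) = mret 0 k.
Proof. by rewrite /mstep !npairE. Qed.

Lemma mstep_succ : mstep (mstate (rcode RSucc) v k) = mret (nhd v).+1 k.
Proof. by rewrite /mstep !npairE. Qed.

Lemma mstep_proj i :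
  mstep (mstate (rcode (RProj i)) v k) = mret (nhd (iter i ntl v)) k.
Proof. by rewrite /mstep !npairE. Qed.

Lemma mstep_comp f gs : mstep (mstate (rcode (RComp f gs)) v k) =
  mstate (margs (rcode f) (rcodes gs) 0) v k.
Proof. by rewrite /mstep !npairE. Qed.

Lemma mstep_args0 f ws :
  mstep (mstate (margs f 0 ws) v k) = mstate f ws k.
Proof. by rewrite /mstep !npairE. Qed.

Lemma mstep_args f g gs ws : mstep (mstate (margs f (npair g gs) ws) v k) =
  mstate g v (npair (fargs v f gs ws) k).
Proof. by rewrite /mstep !npairE. Qed.

Lemma mstep_fargs y v' f gs ws : mstep (mret y (npair (fargs v' f gs ws) k)) =
  mstate (margs f gs (npair y ws)) v' k.
Proof. by rewrite /mstep /mreturn !npairE. Qed.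

Lemma mstep_prec0 f g :
  mstep (mstate (rcode (RPrec f g)) (npair 0 v) k) = mstate (rcode f) v k.
Proof. by rewrite /mstep !npairE. Qed.

Lemma mstep_precS f g n :
  mstep (mstate (rcode (RPrec f g)) (npair n.+1 v) k) =
  mstate (rcode (RPrec f g)) (npair n v) (npair (fprec (rcode g) n v) k).
Proof. by rewrite /mstep !npairE /= subn1. Qed.

Lemma mstep_prec_nil f g : mstep (mstate (rcode (RPrec f g)) 0 k) =
  mstate (rcode (RPrec f g)) 0 k.
Proof. by rewrite /mstep !npairE. Qed.

Lemma mstep_fprec z g n : mstep (mret z (npair (fprec g n v) k)) =
  mstate g (npair n (npair z v)) k.
Proof. by rewrite /mstep /mreturn !npairE. Qed.

Lemma mstep_mu f : mstep (mstate (rcode (RMu f)) v k) =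
  mstate (rcode f) (npair 0 v) (npair (fmu (rcode f) 0 v) k).
Proof. by rewrite /mstep !npairE. Qed.

Lemma mstep_fmu0 f n : mstep (mret 0 (npair (fmu f n v) k)) = mret n k.
Proof. by rewrite /mstep /mreturn !npairE. Qed.

Lemma mstep_fmuS y f n : mstep (mret y.+1 (npair (fmu f n v) k)) =
  mstate f (npair n.+1 v) (npair (fmu f n.+1 v) k).
Proof. by rewrite /mstep /mreturn !npairE. Qed.

Lemma mstep_ret y : mstep (mret y 0) = mret y 0.
Proof. by rewrite /mstep !npairE. Qed.

End Step.

(* Completeness and soundness of the machine *)
Opaque mstep.

Definition reach s s' := exists N, iter N mstep s = s'.

Lemma reach_refl s : reach s s. Proof. by exists 0. Qed.

Lemma reach_step s s' : reach (mstep s) s' -> reach s s'.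
Proof. by move=> [N <-]; exists N.+1; rewrite iterSr. Qed.

Lemma reach_trans s1 s2 s3 : reach s1 s2 -> reach s2 s3 -> reach s1 s3.
Proof. by move=> [N <-] [M <-]; exists (M + N); rewrite iterD. Qed.

(** Induction on the last argument, which the reversed coding puts at the head. Each value is pushed
    in front of the earlier ones, so the finished list is in the original order. *)
Lemma reach_args f gs ws v k ws2 : size ws = size gs ->
  (forall i, i < size gs -> forall k,
    reach (mstate (rcode (nth RZero gs i)) v k) (mret (nth 0 ws i) k)) ->
  reach (mstate (margs f (rcodes gs) ws2) v k)
        (mstate (margs f 0 (foldr npair ws2 ws)) v k).
Proof.
elim/last_ind: gs ws ws2 => [|gs g IH] ws ws2.
  by move=> /size0nil -> _; exact: reach_refl.
case/lastP: ws => [|ws w]; rewrite !size_rcons // => -[szw] H.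
rewrite rcodes_rcons; apply: reach_step; rewrite mstep_args.
have := H _ (ltnSn _) (npair (fargs v f (rcodes gs) ws2) k).
rewrite nth_rcons ltnn eqxx -szw nth_rcons ltnn eqxx => /reach_trans; apply.
apply: reach_step; rewrite mstep_fargs foldr_rcons.
apply: IH => // i lti k'; have {H} := H _ (leqW lti) k'.
rewrite !nth_rcons szw lti; exact: id.
Qed.

Lemma receval_reach c v y : receval c v y ->
  forall k, reach (mstate (rcode c) (enc_seq v) k) (mret y k).
Proof.
elim=> {c v y}.
- by move=> v k; apply: reach_step; rewrite mstep_zero; exact: reach_refl.
- move=> v k; apply: reach_step; rewrite mstep_succ -(nth_enc_seq 0).
  exact: reach_refl.
- move=> i v k; apply: reach_step; rewrite mstep_proj nth_enc_seq.
  exact: reach_refl.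
- move=> f gs v ws y szw _ IHg _ IHf k; apply: reach_step; rewrite mstep_comp.
  apply: (reach_trans (reach_args _ _ _ szw IHg)).
  by apply: reach_step; rewrite mstep_args0; exact: IHf.
- by move=> f g v y _ IH k; apply: reach_step; rewrite mstep_prec0; exact: IH.
- move=> f g n v z y _ IHz _ IHg k; apply: reach_step; rewrite mstep_precS.
  apply: (reach_trans (IHz _)).
  by apply: reach_step; rewrite mstep_fprec; exact: IHg.
- move=> f n v u _ IHu _ IH0 k; apply: reach_step; rewrite mstep_mu.
  (* Each trial below [n] returns a positive value, upon which the frame starts the next trial. *)
  have H m : m <= n -> reach (mstate (rcode f) (enc_seq (0 :: v))
      (npair (fmu (rcode f) 0 (enc_seq v)) k))
    (mstate (rcode f) (enc_seq (m :: v))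
      (npair (fmu (rcode f) m (enc_seq v)) k)).
    elim: m => [|m IH] lt; first exact: reach_refl.
    apply: (reach_trans (IH (ltnW lt))); apply: (reach_trans (IHu _ lt _)).
    by apply: reach_step; rewrite mstep_fmuS; exact: reach_refl.
  apply: (reach_trans (H _ (leqnn n))); apply: (reach_trans (IH0 _)).
  by apply: reach_step; rewrite mstep_fmu0; exact: reach_refl.
Qed.

Definition mfinal s y :=
  [&& nhd (nhd s) == 0, ntl (nhd s) == y & ntl (ntl s) == 0].

Definition mhalts N s y := mfinal (iter N mstep s) y.

Lemma mhaltsE N s y : (nhd (nhd s) != 0) || (ntl (ntl s) != 0) ->
  mhalts N s y -> exists2 N', N = N'.+1 & mhalts N' (mstep s) y.
Proof.
case: N => [|N] H; last by rewrite /mhalts iterSr; exists N.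
by rewrite /mhalts /= /mfinal => /and3P[h1 _ h2]; rewrite h1 h2 in H.
Qed.

(** Soundness with an arbitrary stack: a halting run must pass through the return of [c] to [k],
    with strictly fewer steps left. The induction is on steps because recursion and minimisation run
    the same program again. *)
Definition msound N := forall c v k y,
  mhalts N (mstate (rcode c) (enc_seq v) k) y ->
  exists y' M, [/\ M < N, receval c v y' & mhalts M (mret y' k) y].

Lemma mhalts_args N0 f v k y : (forall N, N < N0 -> msound N) ->
  forall gs N ws2, N <= N0 ->
  mhalts N (mstate (margs f (rcodes gs) ws2) (enc_seq v) k) y ->
  exists ws M, [/\ M <= N, size ws = size gs,
    forall i, i < size gs -> receval (nth RZero gs i) v (nth 0 ws i)
    & mhalts M (mstate (margs f 0 (foldr npair ws2 ws)) (enc_seq v) k) y].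
Proof.
move=> IH; elim/last_ind => [|gs g IHgs] N ws2 leN.
  by move=> H; exists [::], N.
rewrite rcodes_rcons => /mhaltsE[|N1 eN]; first by rewrite /mstate !npairE.
rewrite mstep_args => /IH[|y1 [M1 [lt1 ev1]]]; first by rewrite -eN.
move=> /mhaltsE[|N2 eM1]; first by rewrite /mret /mstate !npairE orbT.
rewrite mstep_fargs => /IHgs[|ws [M [leM szw ev H]]].
  by apply: leq_trans leN; rewrite eN; apply: ltnW; rewrite ltnS; lia.
exists (rcons ws y1), M; split.
- by lia.
- by rewrite !size_rcons szw.
- move=> i; rewrite size_rcons ltnS !nth_rcons szw leq_eqVlt => /predU1P[->|lti].
    by rewrite ltnn eqxx.
  by rewrite lti; exact: ev.
- by rewrite foldr_rcons.
Qed.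

(** The number of trials is not known in advance, so the induction is on the steps left, and the
    failure of the trials below [n] is carried along as a hypothesis. *)
Lemma mhalts_mu N0 f v k y : (forall N, N < N0 -> msound N) ->
  forall N n, N < N0 -> (forall m, m < n -> exists z, receval f (m :: v) z.+1) ->
  mhalts N (mstate (rcode f) (enc_seq (n :: v))
    (npair (fmu (rcode f) n (enc_seq v)) k)) y ->
  exists y' M, [/\ M < N, receval (RMu f) v y' & mhalts M (mret y' k) y].
Proof.
move=> IH; elim/ltn_ind => N IHN n ltN Hn.
move=> /(IH _ ltN)[z [M [ltM ev]]].
move=> /mhaltsE[|M' eM]; first by rewrite /mret /mstate !npairE orbT.
case: z ev => [|z] ev; last first.
  rewrite mstep_fmuS => /IHN[| | |y' [M2 [lt2 ev2 H2]]]; try lia.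
    move=> m; rewrite ltnS leq_eqVlt => /predU1P[->|]; last exact: Hn.
    by exists z.
  by exists y', M2; split=> //; lia.
rewrite mstep_fmu0 => H; exists n, M'; split => //; first lia.
(* [EMu] wants the values of the failed trials as one total function; from [n] on they are
   arbitrary. *)
have /choice[u Hu] m : exists z, m < n -> receval f (m :: v) z.+1.
  by case: (ltnP m n) => [/Hn[z ?]|]; [exists z|exists 0].
exact: EMu Hu ev.
Qed.

Lemma mhalts_receval N : msound N.
Proof.
elim/ltn_ind: N => N IH c v k y H.
have [|N1 eN] := mhaltsE _ H; first by case: c H => *; rewrite /mstate /= !npairE.
case: c H => [||i|f gs|f g|f] H.
- rewrite mstep_zero => H1; exists 0, N1; split; [lia|exact: EZero|by []].
- rewrite mstep_succ => H1; exists (nhd (enc_seq v)).+1, N1.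
  split; [lia| |by []].
  by rewrite (nth_enc_seq 0); exact: ESucc.
- rewrite mstep_proj nth_enc_seq => H1; exists (nth 0 v i), N1.
  split; [lia|exact: EProj|by []].
- rewrite mstep_comp => /(mhalts_args IH)[|ws [M [leM szw ev]]]; first by lia.
  move=> /mhaltsE[|M2 eM]; first by rewrite /mstate !npairE.
  rewrite mstep_args0 => /IH[|y' [M3 [lt3 ev3 H3]]]; first by lia.
  by exists y', M3; split=> //; [lia|exact: EComp szw ev ev3].
- case: v H => [|[|n] v] H.
  + by move: H; rewrite /mhalts iter_fix ?mstep_prec_nil // /mfinal /mstate !npairE.
  + rewrite mstep_prec0 => /IH[|y' [M [lt ev H1]]]; first by lia.
    by exists y', M; split=> //; [lia|exact: EPrec0].
  + rewrite mstep_precS => /(IH _ _ _ (n :: v))[|z [M [lt ev]]]; first by lia.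
    move=> /mhaltsE[|M2 eM]; first by rewrite /mret /mstate !npairE orbT.
    rewrite mstep_fprec => /(IH _ _ _ [:: n, z & v])[|y' [M3 [lt3 ev3 H3]]].
      by lia.
    by exists y', M3; split=> //; [lia|exact: EPrecS ev ev3].
- rewrite mstep_mu => /(mhalts_mu IH)[| |y' [M [lt ev H1]]] //; first by lia.
  by exists y', M; split=> //; lia.
Qed.

(* The value 0 stands for a run that has not terminated. *)
Definition univ e n k :=
  let s := iter (ntl k) mstep (mstate e (npair (nhd k) (npair n 0)) 0) in
  if (nhd (nhd s) == 0) && (ntl (ntl s) == 0) then ntl (nhd s) else 0.

Lemma tr_univ : tr3 univ.
Proof.
rewrite /tr3 /tr2 /univ; cbv zeta.
have h : total_recursive (fun x => iter (ntl (ntl (ntl x))) mstep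
   (mstate (nhd x) (npair (nhd (ntl (ntl x))) (npair (nhd (ntl x)) 0)) 0)).
  apply: (@tr_iter _ _ (fun _ => mstep)); try by rewrite /mstate; tr.
  apply: (@tr_comp mstep _ tr_mstep). tr.
repeat first [exact: h | tr_step].
Qed.

(** [k] packs an enumeration index with a step bound. This dovetailing makes the set listed by [c]
    the range of a total function, up to the dummy value 0, which is why [y] is positive. *)
Lemma univP c n y : 0 < y ->
  (exists k, receval c [:: k; n] y) <-> (exists k, univ (rcode c) n k = y).
Proof.
move=> y0; split=> [[k /receval_reach /(_ 0) [N]]|[k]].
  by move=> E; exists (npair k N); rewrite /univ !npairE E /mret /mstate !npairE.
rewrite /univ; case: ifP => [/andP[h1 h2] e|_ y0']; last by rewrite -y0' in y0.
exists (nhd k); have : mhalts (ntl k)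
    (mstate (rcode c) (enc_seq [:: nhd k; n]) 0) y.
  by rewrite /mhalts /mfinal h1 h2 e eqxx.
move=> /mhalts_receval[y' [M [_ ev H]]].
suff -> : y = y' by [].
have E M' : iter M' mstep (mret y' 0) = mret y' 0.
  by rewrite iter_fix // mstep_ret.
by move: H; rewrite /mhalts E /mfinal /mret /mstate !npairE => /and3P[_ /eqP].
Qed.

(** * Enumerable open sets and Bernoulli measure *)

Lemma string_code_rcons x b : string_code (rcons x b) = (string_code x).*2 + b.
Proof. by rewrite /string_code foldl_rcons. Qed.

Lemma string_code_gt0 x : 0 < string_code x.
Proof.
elim/last_ind: x => // x b IH; rewrite string_code_rcons.
by rewrite addn_gt0 double_gt0 IH.
Qed.

Lemma string_code_inj : injective string_code.
Proof.
elim/last_ind => [|x b IH] x'; case/lastP: x' => [|x' b'] //.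
- rewrite string_code_rcons; have := string_code_gt0 x'.
  by rewrite /string_code /=; lia.
- rewrite string_code_rcons; have := string_code_gt0 x.
  by rewrite /string_code /=; lia.
- rewrite !string_code_rcons => E.
  have Ex : string_code x = string_code x' by case: (b) (b') E => -[] /=; lia.
  by rewrite (IH _ Ex); congr rcons; case: (b) (b') E => -[] //=; lia.
Qed.

Lemma string_code_bounds x :
  2 ^ size x <= string_code x < 2 ^ (size x).+1.
Proof.
elim/last_ind: x => // x b; rewrite string_code_rcons size_rcons !expnS.
by case: b => /=; lia.
Qed.

Lemma string_code_onto s i : i < 2 ^ s ->
  exists2 x, size x = s & string_code x = 2 ^ s + i.
Proof.
elim: s i => [|s IH] i; first by case: i => // _; exists [::].
rewrite expnS => lti; have [|x sx Ex] := IH i./2; first by lia.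
exists (rcons x (odd i)); first by rewrite size_rcons sx.
by rewrite string_code_rcons Ex; lia.
Qed.

(** The leading 1 records the length, and halving drops the last bit: iterated halves of this number
    are the codes of the shorter prefixes of [w]. *)
Definition cd (w : nat -> bool) s := string_code (mkseq w s).

Lemma cdS w s : cd w s.+1 = (cd w s).*2 + w s.
Proof. by rewrite /cd mkseqS string_code_rcons. Qed.

Lemma cd_gt0 w s : 0 < cd w s.
Proof. exact: string_code_gt0. Qed.

Lemma cd_bounds w s : 2 ^ s <= cd w s < 2 ^ s.+1.
Proof. by have := string_code_bounds (mkseq w s); rewrite size_mkseq. Qed.

Lemma half_cd w s : (cd w s.+1)./2 = cd w s.
Proof. by rewrite cdS; case: (w s); lia. Qed.

Lemma iter_half_cd w s i : i <= s -> iter i half (cd w s) = cd w (s - i).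
Proof.
elim: i => [|i IH] le; first by rewrite subn0.
by rewrite iterS IH 1?ltnW // -[in RHS]half_cd -subSn.
Qed.

Lemma odd_cd w s : odd (cd w s.+1) = w s.
Proof. by rewrite cdS; case: (w s); lia. Qed.

Lemma cd_prefix w x : (exists s, cd w s = string_code x) <-> prefix_interval x w.
Proof.
split=> [[s /string_code_inj]|]; last by exists (size x); rewrite /cd H.
by rewrite /prefix_interval /= => <-; rewrite size_mkseq.
Qed.

Lemma enum_openE c v (w : Omega) :
  enum_open c v w <-> exists k s, receval c (k :: v) (cd w s).
Proof.
split=> [[x [k ck] /cd_prefix[s E]]|[k [s H]]]; first by exists k, s; rewrite E.
exists (mkseq w s); first by exists k.
by apply/cd_prefix; exists s.
Qed.

(* [H] enumerates codes of strings; the value 0 codes no string. *)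
Definition covered (H : nat -> nat) : set Omega :=
  [set w | exists k s, H k = cd w s].

(** A single [s] bounds both the number of listed strings and their length. Hence stage [s] depends
    on [s] bits only, is decidable, and the stages increase to [covered H]. *)
Definition cov (H : nat -> nat) s y :=
  bexn s (fun k => bexn s.+1 (fun i => iter i half y == H k)).

Lemma cov_cd H w s :
  reflect (exists k s', [/\ k < s, s' <= s & H k = cd w s']) (cov H s (cd w s)).
Proof.
apply: (iffP (bexnP _ _)) => [[k ltk /bexnP[i lei /eqP E]]|[k [s' [ltk les E]]]].
  by exists k, (s - i); split; rewrite ?leq_subr // -E iter_half_cd.
exists k => //; apply/bexnP; exists (s - s'); first by rewrite ltnS leq_subr.
by rewrite iter_half_cd ?leq_subr // subKn // E.
Qed.

Lemma cov_mono H w s s' : s <= s' -> cov H s (cd w s) -> cov H s' (cd w s').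
Proof.
move=> le /cov_cd[k [t [ltk let_ E]]]; apply/cov_cd; exists k, t.
by split=> //; [exact: leq_trans le|exact: leq_trans le].
Qed.

Lemma coveredE H w : covered H w <-> exists s, cov H s (cd w s).
Proof.
split=> [[k [s E]]|[s /cov_cd[k [s' [_ _ E]]]]]; last by exists k, s'.
exists (k.+1 + s); apply/cov_cd; exists k, s.
by rewrite leq_addr leq_addl.
Qed.

(** For the code [y] of a string of length [s] this is the product of [u] over its bits. The
    semiring is a parameter so that integer numerators and real probabilities share one
    definition. *)
Fixpoint wt (T : pzSemiRingType) (u : bool -> T) (y s : nat) : T :=
  if s is s'.+1 then (u (odd y) * wt u y./2 s')%R else 1%R.

Local Open Scope ring_scope.

Lemma wt_string_code (T : comPzSemiRingType) (u : bool -> T) x :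
  wt u (string_code x) (size x) = \prod_(b <- x) u b.
Proof.
elim/last_ind: x => [|x b IH]; first by rewrite big_nil.
rewrite size_rcons string_code_rcons big_rcons /= -IH mulrC.
have -> : odd ((string_code x).*2 + b)%N = b by case: b; lia.
by have -> : ((string_code x).*2 + b)./2 = string_code x by case: b; lia.
Qed.

Lemma measurable_prefix x : measurable (prefix_interval x : set Omega).
Proof. by apply: sub_sigma_algebra; exists x. Qed.

Lemma measurable_cd s y : measurable [set w : Omega | cd w s = y].
Proof.
have [[x E]|H] := pselect (exists w : Omega, cd w s = y).
  rewrite (_ : [set _ | _] = prefix_interval (mkseq x s)).
    exact: measurable_prefix.
  apply/seteqP; split=> w /=; rewrite -E /prefix_interval /= size_mkseq.
    exact: string_code_inj.
  by rewrite /cd => ->.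
rewrite (_ : [set _ | _] = set0); first exact: measurable0.
by apply/seteqP; split=> // w /= E; apply: H; exists w.
Qed.

Lemma measurable_cdP s (P : nat -> bool) :
  measurable [set w : Omega | P (cd w s)].
Proof.
rewrite (_ : [set _ | _] =
    \bigcup_(y in [set y | P y]) [set w : Omega | cd w s = y]).
  by apply: bigcup_measurable => y _; exact: measurable_cd.
by apply/seteqP; split=> [w /= Pw|w [y /= Py ->//]]; exists (cd w s).
Qed.

Lemma measurable_covered H : measurable (covered H).
Proof.
rewrite (_ : covered H = \bigcup_s [set w | cov H s (cd w s)]).
  by apply: bigcupT_measurable => s; exact: (@measurable_cdP s (cov H s)).
apply/seteqP; split=> w; first by move=> /coveredE[s]; exists s.
by move=> [s _ ?]; apply/coveredE; exists s.
Qed.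

Section Bernoulli.
Context (R : realType) (p : R) (B : probability Omega R).
Hypothesis hB : is_bernoulli_measure p B.

Lemma bernoulli_cd s i : (i < 2 ^ s)%N ->
  B [set w : Omega | cd w s = (2 ^ s + i)%N] =
  (wt (bernoulli_pmf p) (2 ^ s + i)%N s)%:E.
Proof.
move=> /string_code_onto[x sx <-]; rewrite -{2}sx wt_string_code -hB.
congr (B _); apply/seteqP; split=> w /=; rewrite /prefix_interval /= sx.
  exact: string_code_inj.
by rewrite /cd => ->.
Qed.

(** The codes of the strings of length [s] are exactly the numbers 2^s + i with i < 2^s, so the
    event is a finite disjoint union of intervals. *)
Lemma bernoulli_cdP s (P : nat -> bool) :
  B [set w : Omega | P (cd w s)] =
  (\sum_(i < 2 ^ s) (P (2 ^ s + i)%N)%:R * wt (bernoulli_pmf p) (2 ^ s + i)%N s)%:E.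
Proof.
pose F (i : 'I_(2 ^ s)) : set Omega :=
  if P (2 ^ s + i)%N then [set w | cd w s = (2 ^ s + i)%N] else set0.
have mF i : measurable (F i) by rewrite /F; case: ifP => // _; exact: measurable_cd.
rewrite (_ : [set _ | _] = \big[setU/set0]_(i < (2 ^ s)%N) F i); last first.
  rewrite -bigcup_seq; apply/seteqP; split=> [w /= Pw|w [i _]]; last first.
    by rewrite /F; case: ifP => //= Pi ->.
  have lti : (cd w s - 2 ^ s < 2 ^ s)%N.
    by have := cd_bounds w s; rewrite expnS; lia.
  have E : (2 ^ s + (cd w s - 2 ^ s))%N = cd w s.
    by have := cd_bounds w s; lia.
  by exists (Ordinal lti); rewrite /= ?mem_index_enum // /F /= E Pw.
rewrite measure_semi_additive_ord //; last 2 first.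
- apply/trivIsetP => i j _ _ ij; apply/seteqP; split=> // w [].
  rewrite /F; case: ifP => // _ Ei; case: ifP => //= _ Ej.
  by move: ij; rewrite -val_eqE /=; move: Ei Ej => /= -> /addnI ->; rewrite eqxx.
- by apply: bigsetU_measurable => i _; exact: mF.
rewrite -sumEFin; apply: eq_bigr => i _; rewrite /F.
case: ifP => _; last by rewrite measure0 mul0r.
by rewrite mul1r; apply: bernoulli_cd.
Qed.

End Bernoulli.

(** The selected stages need not form an initial segment. [F s] repeats the last one selected up to
    [s], which gives a nondecreasing sequence with the same union, and continuity from below
    preserves the bound. *)
Lemma measure_bigcup_selected d (T : measurableType d) (R : realType)
    (mu : {measure set T -> \bar R}) (S : nat -> set T) (P : set nat) c :
  (0 <= c)%E -> (forall s, measurable (S s)) ->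
  (forall s, S s `<=` S s.+1) -> (forall s, P s -> mu (S s) <= c)%E ->
  (mu (\bigcup_(s in P) S s) <= c)%E.
Proof.
move=> c0 mS ndS leS.
pose F := fix F s := if `[< P s >] then S s else
  if s is s'.+1 then F s' else set0.
have mF s : measurable (F s).
  by elim: s => [|s IH] /=; case: asboolP => // _; exact: mS.
have FS s : F s `<=` S s.
  elim: s => [|s IH] /=; case: asboolP => _; try by move=> w.
  by move=> w /IH; exact: ndS.
have Fle s : (mu (F s) <= c)%E.
  by elim: s => [|s IH] /=; case: asboolP => // h; rewrite ?measure0 //; exact: leS.
have ndF : {homo F : n m / (n <= m)%N >-> (n <= m)%O}.
  apply: homo_leq => [x|y x z|s]; [exact: lexx|exact: le_trans|].
  rewrite subsetEset /=; case: asboolP => _ w //.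
  by move=> /FS; exact: ndS.
rewrite (_ : \bigcup_(s in P) S s = \bigcup_s F s); last first.
  apply/seteqP; split=> w [s Ps Sw].
    by exists s => //; case: s Ps Sw => [|s] Ps Sw /=; rewrite asboolT.
  elim: s {Ps} Sw => [|s IH] /=; case: asboolP => Ps Sw.
  - by exists 0%N.
  - by [].
  - by exists s.+1.
  - exact: IH.
have mU : measurable (\bigcup_s F s) by exact: bigcupT_measurable.
have h := @nondecreasing_cvg_mu _ _ _ mu F mF mU ndF.
rewrite -(cvg_lim _ h) //; apply: lime_le.
  by apply/cvg_ex; exists (mu (\bigcup_s F s)).
by apply: nearW => s; exact: Fle.
Qed.

(** Splits off the most significant of the digits and leaves [y] unchanged, as primitive recursion
    on [s] with parameter [y] requires. *)
Lemma wtSr (T : pzSemiRingType) (u : bool -> T) y s :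
  wt u y s.+1 = wt u y s * u (odd (iter s half y)).
Proof.
elim: s y => [|s IH] y; first by rewrite /= mulr1 mul1r.
have -> : wt u y s.+2 = u (odd y) * wt u y./2 s.+1 by [].
by rewrite IH mulrA -iterSr.
Qed.

Lemma wt_natr (T : pzSemiRingType) (u : bool -> nat) y s :
  (wt u y s)%:R = wt (fun b => (u b)%:R : T) y s.
Proof. by elim: s y => //= s IH y; rewrite natrM IH. Qed.

Lemma wt_div (K : fieldType) (u : bool -> K) c y s :
  wt (fun b => u b / c) y s = wt u y s / c ^+ s.
Proof.
elim: s y => [|s IH] y; first by rewrite /= expr0 divr1.
by rewrite /= IH exprS invfM; ring.
Qed.

Lemma ler_wt (K : numDomainType) (u v : bool -> K) y s :
  (forall b, 0 <= u b <= v b) -> 0 <= wt u y s <= wt v y s.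
Proof.
move=> uv; elim: s y => [|s IH] y /=; first by rewrite ler01 lexx.
have /andP[u0 uv1] := uv (odd y); have /andP[w0 wv1] := IH y./2.
by rewrite mulr_ge0 //= ler_pM.
Qed.

Lemma cvg_wt (R : realType) (u : nat -> bool -> R) (v : bool -> R) y s :
  (forall b, u j b @[j --> \oo] --> v b) ->
  wt (u j) y s @[j --> \oo] --> wt v y s.
Proof.
move=> uv; elim: s y => [|s IH] y /=; first exact: cvg_cst.
by apply: cvgM; [exact: uv|exact: IH].
Qed.

Lemma tr_wt (a0 a1 y s : nat -> nat) :
  total_recursive a0 -> total_recursive a1 -> total_recursive y ->
  total_recursive s ->
  total_recursive (fun x => wt (fun b => if b then a1 x else a0 x) (y x) (s x)).
Proof.
move=> h0 h1 hy hs; apply: (@tr_ext (fun x => nat_rect (fun=> nat) 1%N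
  (fun i r => (r * (if odd (iter i half (y x)) then a1 x else a0 x))%N) (s x))).
  by move=> x; elim: (s x) => // n IH; rewrite wtSr /= IH.
apply: (@tr_rec _ (fun=> 1%N) _ _ (fun i r x =>
  (r * (if odd (iter i half (y x)) then a1 x else a0 x))%N)) => //.
  exact: tr_const.
have ht f : total_recursive f -> total_recursive (fun z => f (ntl (ntl z))).
  by move=> /tr_comp; apply; tr.
apply: tr_mul; first by tr.
apply: tr_if; [exact: ht|exact: ht|apply: tr_odd].
by apply: (@tr_iter _ _ (fun _ => half)); [tr|exact: ht|tr].
Qed.

(** Adding 2^-j to an approximation with error 2^-j gives an upper bound, and doubles the possible
    error. Both probabilities get the same denominator, so all weights of strings of length [s] have
    the common denominator [d j ^ s]. *)
Lemma computable_real_approx (R : realType) (p : R) : 0 <= p -> p <= 1 ->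
  computable_real p -> exists (a : bool -> nat -> nat) (d : nat -> nat),
  [/\ forall b, total_recursive (a b), total_recursive d,
    forall j, (0 < d j)%N
    & forall j b, let q := (a b j)%:R / (d j)%:R : R in
      bernoulli_pmf p b <= q <= bernoulli_pmf p b + 2 * 2 ^- j].
Proof.
move=> p0 p1 [q qc qp].
pose sg j := nat_of_bool (q j < 0); pose nm j := `|numq (q j)|%N.
pose dn j := `|denq (q j)|%N.
have hsg : total_recursive sg by exact: (qc 0%N isT).
have hnm : total_recursive nm by exact: (qc 1%N isT).
have hdn : total_recursive dn by exact: (qc 2%N isT).
(* A negative approximation is replaced by 0, which is no farther from [p] as [p] is
   non-negative. *)
pose m j := if sg j == 0%N then nm j else 0%N.
have hm : total_recursive m by apply: tr_if => //; [tr|apply: tr_eq => //; tr].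
exists (fun b j => ((if b then m j else dn j - m j) * 2 ^ j + dn j)%N).
exists (fun j => (dn j * 2 ^ j)%N); split.
- by case; apply: tr_add => //; apply: tr_mul => //; try apply: tr_sub => //;
    by apply: tr_exp; tr.
- by apply: tr_mul => //; apply: tr_exp; tr.
- by move=> j; rewrite muln_gt0 expn_gt0 /= andbT /dn absz_gt0.
move=> j b /=.
have dn0 : 0 < (dn j)%:R :> R by rewrite ltr0n /dn absz_gt0.
have e0 : 0 < 2 ^- j :> R by rewrite invr_gt0 exprn_gt0.
have E2 : (2 ^ j)%:R * 2 ^- j = 1 :> R by rewrite natrX divff // expf_neq0.
have qd : `|p - (m j)%:R / (dn j)%:R| <= 2 ^- j.
  have dnE : (dn j)%:R = (denq (q j))%:~R :> R by rewrite /dn pmulrn absz_denq.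
  apply: le_trans (qp j); rewrite /m /sg; case: ltP => q0 /=.
    have q0' : ratr (q j) <= 0 :> R by rewrite lerq0 ltW.
    by rewrite mul0r subr0 ger0_norm // ger0_norm; lra.
  have nmE : (nm j)%:R = (numq (q j))%:~R :> R.
    by rewrite /nm pmulrn gez0_abs // numq_ge0.
  by rewrite dnE nmE.
have EX k : (k * 2 ^ j + dn j)%:R / (dn j * 2 ^ j)%:R =
    k%:R / (dn j)%:R + 2 ^- j :> R.
  by rewrite natrD !natrM natrX; field; rewrite expf_neq0 // gt_eqF.
rewrite EX; move: qd; rewrite ler_norml => /andP[q1 q2].
case: b => /=; first by lra.
(* If the approximation exceeds 1, truncated subtraction gives 0, which is within 2^-j of 1 - p
   because p <= 1. *)
have [le|lt] := leqP (m j) (dn j).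
  by rewrite natrB // mulrBl divff ?gt_eqF //; lra.
have -> : (dn j - m j = 0)%N by apply/eqP; rewrite subn_eq0 ltnW.
have : 1 < (m j)%:R / (dn j)%:R :> R by rewrite ltr_pdivlMr // mul1r ltr_nat.
by rewrite mul0r; lra.
Qed.

(** * A universal Martin-Loef test *)

Section UniversalTest.
Context (R : realType) (p : R) (B : probability Omega R).
Hypothesis hB : is_bernoulli_measure p B.
Hypotheses (p0 : 0 <= p) (p1 : p <= 1).
Context (a : bool -> nat -> nat) (d : nat -> nat).
Hypotheses (ha : forall b, total_recursive (a b)) (hd : total_recursive d)
  (d0 : forall j, (0 < d j)%N)
  (ad : forall j b, let q := (a b j)%:R / (d j)%:R : R in
      bernoulli_pmf p b <= q <= bernoulli_pmf p b + 2 * 2 ^- j).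

(* Certifies, through the [j]-th upper approximations of [p] and [1 - p], that
   the part of the [e]-th enumerable set listed by stage [s] has measure less
   than [2 * 2 ^- n]. *)
Definition small e n s j : bool :=
  (bsum (2 ^ s) (fun i => cov (univ e n) s (2 ^ s + i) *
      wt (fun b => if b then a true j else a false j) (2 ^ s + i) s) * 2 ^ n <
   2 * d j ^ s)%N.

Definition stage e n s : set Omega := [set w | cov (univ e n) s (cd w s)].

Let u j b : R := (a b j)%:R / (d j)%:R.

Lemma smallE e n s j : small e n s j =
  (\sum_(i < 2 ^ s) (cov (univ e n) s (2 ^ s + i))%:R * wt (u j) (2 ^ s + i) s
   < 2 / 2 ^+ n).
Proof.
have dj : 0 < (d j)%:R :> R by rewrite ltr0n.
rewrite /small -(ltr_nat R) !natrM !natrX.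
rewrite [in RHS](_ : \sum_(i < _) _ = (bsum (2 ^ s)
    (fun i => cov (univ e n) s (2 ^ s + i) *
      wt (fun b => if b then a true j else a false j) (2 ^ s + i) s)%N)%:R
    / (d j)%:R ^+ s).
  by rewrite ltr_pdivrMr ?exprn_gt0 // mulrAC ltr_pdivlMr ?exprn_gt0.
rewrite /bsum natr_sum mulr_suml; apply: eq_bigr => i _.
rewrite natrM wt_natr -mulrA -wt_div; congr (_ * wt _ _ _).
by apply/funext => -[].
Qed.

Lemma bernoulli_stage e n s : B (stage e n s) =
  (\sum_(i < 2 ^ s) (cov (univ e n) s (2 ^ s + i))%:R *
    wt (bernoulli_pmf p) (2 ^ s + i) s)%:E.
Proof. exact: (bernoulli_cdP hB). Qed.

Lemma small_le e n s j : small e n s j -> (B (stage e n s) <= (2 / 2 ^+ n)%:E)%E.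
Proof.
rewrite smallE bernoulli_stage lee_fin => /ltW; apply: le_trans.
apply: ler_sum => i _; apply: ler_wpM2l => //.
suff /andP[] : 0 <= wt (bernoulli_pmf p) (2 ^ s + i) s
    <= wt (u j) (2 ^ s + i) s by [].
apply: ler_wt => b; rewrite bernoulli_pmf_ge0 ?p0 ?p1 //=.
by have /andP[] := ad j b.
Qed.

(** The factor 2 in [small] leaves strict room above 2^-n. The stage is a finite sum of weights, so
    its upper approximations converge to its measure and finally drop below 2 * 2^-n. *)
Lemma small_exists e n s : (B (stage e n s) <= (2 ^- n)%:E)%E ->
  exists j, small e n s j.
Proof.
rewrite bernoulli_stage lee_fin => le.
have uB b : u j b @[j --> \oo] --> bernoulli_pmf p b.
  apply: (@squeeze_cvgr _ _ _ _ (fun=> bernoulli_pmf p b)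
    (fun j => bernoulli_pmf p b + geometric 2 2^-1 j)).
  - by apply: nearW => j; have := ad j b; rewrite /= exprVn.
  - exact: cvg_cst.
  - rewrite -[X in _ --> X]addr0; apply: cvgD; first exact: cvg_cst.
    by apply: cvg_geometric; rewrite ger0_norm ?invr_ge0 // invf_lt1 // ltr1n.
have lt : \sum_(i < 2 ^ s) (cov (univ e n) s (2 ^ s + i))%:R *
    wt (bernoulli_pmf p) (2 ^ s + i) s < 2 / 2 ^+ n.
  by apply: (le_lt_trans le); rewrite ltr_pMl ?invr_gt0 ?exprn_gt0 // ltr1n.
have cvg : \sum_(i < 2 ^ s) (cov (univ e n) s (2 ^ s + i))%:R *
    wt (u j) (2 ^ s + i) s @[j --> \oo] -->
    \sum_(i < 2 ^ s) (cov (univ e n) s (2 ^ s + i))%:R *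
    wt (bernoulli_pmf p) (2 ^ s + i) s.
  apply: cvg_big => [|i _]; first exact: add_continuous.
  by apply: cvgM; [exact: cvg_cst|exact: cvg_wt].
have [j _ /(_ j (leqnn j))] := cvgr_lt _ cvg _ lt.
by rewrite /= -smallE; exists j.
Qed.

Definition trimmed e n : set Omega :=
  \bigcup_(s in [set s | exists j, small e n s j]) stage e n s.

Lemma measurable_stage e n s : measurable (stage e n s).
Proof. exact: (@measurable_cdP s (cov (univ e n) s)). Qed.

Lemma measurable_trimmed e n : measurable (trimmed e n).
Proof. by apply: bigcup_measurable => s _; exact: measurable_stage. Qed.

Lemma bernoulli_trimmed e n : (B (trimmed e n) <= (2 / 2 ^+ n)%:E)%E.
Proof.
apply: measure_bigcup_selected.
- by rewrite lee_fin divr_ge0 // exprn_ge0.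
- by move=> s; exact: measurable_stage.
- by move=> s w; exact: cov_mono.
- by move=> s [j]; exact: small_le.
Qed.

Lemma trimmed_small e n : (B (covered (univ e n)) <= (2 ^- n)%:E)%E ->
  covered (univ e n) `<=` trimmed e n.
Proof.
move=> le w /coveredE[s covs]; exists s => //; apply: small_exists.
apply: le_trans le; apply: le_measure; rewrite ?inE.
- exact: measurable_stage.
- exact: measurable_covered.
- by move=> w' ?; apply/coveredE; exists s.
Qed.

(** [k] packs a program, a stage, a certificate and a string. At level n = m + e + 2 the trimmed set
    has measure at most 2^-(m+e+1), and these bounds add up to 2^-m over all [e]. The range check on
    [y] ensures that it codes a string of length [s], the only case in which [cov] is meaningful. *)
Definition vlist m k :=
  let e := nhd k in let s := nhd (ntl k) in
  let j := nhd (ntl (ntl k)) in let y := ntl (ntl (ntl k)) in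
  let n := (m + e + 2)%N in
  if [&& small e n s j, cov (univ e n) s y, 2 ^ s <= y & y < 2 ^ s.+1]%N
  then y else 0%N.

Lemma tr_vlist : tr2 vlist.
Proof.
rewrite /tr2 /vlist /small /cov; cbv zeta.
repeat lazymatch goal with
| |- total_recursive (fun x => wt _ _ _) => apply: tr_wt
| |- total_recursive (fun x => univ _ _ _) => apply: (tr_comp3 tr_univ)
| |- total_recursive (fun x => a ?b _) => apply: (tr_comp (ha b))
| |- total_recursive (fun x => d _) => apply: (tr_comp hd)
| |- total_recursive (fun x => iter _ half _) =>
    apply: (@tr_iter _ _ (fun _ => half))
| _ => tr_step
end.
Qed.

Lemma covered_vlist m : covered (vlist m) = \bigcup_e trimmed e (m + e + 2).
Proof.
apply/seteqP; split=> w.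
  move=> [k [t]]; rewrite /vlist; set e := nhd k; set s := nhd _.
  set y := ntl _; case: ifP => [/and4P[sm cv y1 y2] Ey|_ E]; last first.
    by have := cd_gt0 w t; rewrite -E.
  have := cd_bounds w t; rewrite -Ey => /andP[y3 y4].
  (* The code determines the length, as the ranges for different lengths are disjoint. *)
  have st : s = t.
    have h1 : (s < t.+1)%N by rewrite -(@ltn_exp2l 2) //; apply: leq_ltn_trans y4.
    have h2 : (t < s.+1)%N by rewrite -(@ltn_exp2l 2) //; apply: leq_ltn_trans y2.
    by apply/eqP; rewrite eqn_leq -ltnS h1 -ltnS h2.
  exists e => //; exists s; first by eexists; exact: sm.
  by rewrite /stage /= [in cd w s]st -Ey.
move=> [e _ [s [j sm] cv]].
exists (npair e (npair s (npair j (cd w s)))), s; rewrite /vlist !(nhdK, ntlK).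
by rewrite sm cv cd_bounds.
Qed.

Lemma bernoulli_vlist m : (B (covered (vlist m)) <= (2 ^- m)%:E)%E.
Proof.
have e0 : 0 <= 2 ^- m :> R by rewrite invr_ge0 exprn_ge0.
apply: le_trans (epsilon_trick0 xpredT e0).
apply: le_trans (_ : _ <= \big[+%E/0%E]_(0 <= e <oo) B (trimmed e (m + e + 2)))%E _.
  apply: measure_sigma_subadditive.
  - by move=> e; exact: measurable_trimmed.
  - exact: measurable_covered.
  - by rewrite covered_vlist.
apply: lee_nneseries => // e _; apply: le_trans (bernoulli_trimmed _ _) _.
rewrite lee_fin natrX !exprD (exprS _ e) le_eqVlt; apply/orP; left; apply/eqP.
by field; rewrite !expf_neq0.
Qed.

(** Only one level of the test matters, namely [m + rcode c + 2]: there [U] satisfies the bound that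
    lets it pass through the trimming unchanged. *)
Lemma martin_lof_test_vlist U m :
  martin_lof_test B U -> \bigcap_n U n `<=` covered (vlist m).
Proof.
move=> [[c Uc] UB] w Uw; rewrite covered_vlist; exists (rcode c) => //.
set n := (m + rcode c + 2)%N.
have E : U n = covered (univ (rcode c) n).
  rewrite Uc; apply/seteqP; split=> x.
    move=> /enum_openE[k [s H]].
    have /(univP _ _ (cd_gt0 _ _))[k' H'] : exists k, receval c [:: k; n] (cd x s).
      by exists k.
    by exists k', s.
  move=> [k [s H]]; apply/enum_openE.
  have /(univP _ _ (cd_gt0 _ _))[k' H'] : exists k, univ (rcode c) n k = cd x s.
    by exists k.
  by exists k', s.
by apply: trimmed_small; rewrite -E; [exact: UB|exact: Uw].
Qed.

End UniversalTest.

(** * Upward closed sets of majorants *)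

Local Open Scope nat_scope.

Definition code_le s x y :=
  balln s (fun i => ~~ odd (iter i half x) || odd (iter i half y)).

Lemma code_le_cd s (w w' : nat -> bool) :
  reflect (forall i, i < s -> w i <= w' i) (code_le s (cd w s) (cd w' s)).
Proof.
have E (v : nat -> bool) i : i < s -> odd (iter i half (cd v s)) = v (s - i.+1).
  move=> lt; rewrite iter_half_cd 1?ltnW //.
  by rewrite (_ : s - i = (s - i.+1).+1); [exact: odd_cd|lia].
apply: (iffP (ballnP _ _)) => H i lt.
  have := H (s - i.+1); rewrite !E; try lia.
  have -> : s - (s - i.+1).+1 = i by lia.
  by case: (w i) (w' i) => [] [] // h; have : false by apply: h; lia.
rewrite !E //; have := H (s - i.+1); case: (w _) (w' _) => [] [] // h.
by have : false by apply: h; lia.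
Qed.

(** König's lemma. If no stage covers all majorants, call a prefix good when uncovered majorants
    pass through it at arbitrarily late stages. Good prefixes extend by a bit, and the resulting
    branch [v] is a majorant. It is covered at some stage, and so is every majorant sharing enough
    bits with it, a contradiction. *)
Lemma cov_compact (H : nat -> nat) (w : Omega) :
  (forall w', omega_le w w' -> covered H w') ->
  exists s, forall w', omega_le w w' -> cov H s (cd w' s).
Proof.
move=> Hw; apply: contrapT => /forallNP nH.
pose good x := forall N, exists s w',
  [/\ N <= s, omega_le w w', mkseq w' (size x) = x & ~ cov H s (cd w' s)].
have good0 : good [::].
  by move=> N; have /existsNP[w' /not_implyP[le nc]] := nH N; exists N, w'.
have goodS x : good x -> exists b, good (rcons x b).
  move=> gx; apply: contrapT => /forallNP nb.
  have /existsNP[N0 h0] := nb false; have /existsNP[N1 h1] := nb true.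
  have [s [w' [leN le Ex nc]]] := gx (maxn N0 N1).
  move: leN; rewrite geq_max => /andP[le0 le1].
  have : mkseq w' (size (rcons x (w' (size x)))) = rcons x (w' (size x)).
    by rewrite size_rcons mkseqS Ex.
  by case: (w' (size x)) => E; [apply: h1|apply: h0]; exists s, w'.
pose nxt x := `[< good (rcons x true) >].
have good_nxt x : good x -> good (rcons x (nxt x)).
  move=> /goodS[[] gx]; rewrite /nxt; first by rewrite asboolT.
  by case: asboolP.
pose pref := fix pref n :=
  if n is n'.+1 then rcons (pref n') (nxt (pref n')) else [::].
pose v : Omega := fun n => nxt (pref n).
have prefE n : pref n = mkseq v n by elim: n => //= n IH; rewrite mkseqS -IH.
have gp n : good (pref n) by elim: n => //= n; exact: good_nxt.
(* At each position some majorant of [w] agrees with [v], which is all that the order asks for. *)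
have vle : omega_le w v.
  move=> i; have [s [w' [_ le E _]]] := gp i.+1 0.
  have := congr1 (nth false ^~ i) E; rewrite prefE size_mkseq !nth_mkseq //.
  by move=> <-; exact: le.
have /coveredE[s0 cv] := Hw _ vle.
have [s [w' [les _ E nc]]] := gp s0 s0.
apply: nc; apply: cov_mono les _; rewrite prefE size_mkseq in E.
by rewrite /cd E.
Qed.

(** A finite check, since [cov] at stage [s] looks at [s] bits only; that some stage passes it is
    the content of [cov_compact]. *)
Definition wlist (H : nat -> nat) k :=
  let x := nhd k in let s := ntl k in
  if (2 ^ s <= x < 2 ^ s.+1) && balln (2 ^ s) (fun i =>
    ~~ code_le s x (2 ^ s + i) || cov H s (2 ^ s + i)) then x else 0.

Lemma covered_wlist H :
  covered (wlist H) = [set w | forall w', omega_le w w' -> covered H w'].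
Proof.
apply/seteqP; split=> w.
  move=> [k [t]]; rewrite /wlist; set x := nhd k; set s := ntl k.
  case: ifP => [/andP[/andP[x1 x2] /ballnP Hx] Ex|_ E]; last first.
    by have := cd_gt0 w t; rewrite -E.
  move=> w' le; have := cd_bounds w t; rewrite -Ex => /andP[x3 x4].
  have st : s = t.
    have h1 : s < t.+1 by rewrite -(@ltn_exp2l 2) //; apply: leq_ltn_trans x4.
    have h2 : t < s.+1 by rewrite -(@ltn_exp2l 2) //; apply: leq_ltn_trans x2.
    by apply/eqP; rewrite eqn_leq -ltnS h1 -ltnS h2.
  apply/coveredE; exists s; have := cd_bounds w' s => /andP[y1 y2].
  have := Hx (cd w' s - 2 ^ s); rewrite subnKC // => /(_ _)/orP[|/negP h|//].
    by move: y2; rewrite expnS; lia.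
  exfalso; apply: h; rewrite Ex -st; apply/code_le_cd => i _; exact: le.
move=> Hw; have [s Hs] := cov_compact Hw.
exists (npair (cd w s) s), s; rewrite /wlist !(nhdK, ntlK) cd_bounds.
case: ballnP => // -[] i lti.
have [x sx Ex] := string_code_onto lti.
(* The default value of [nth] continues [x] with the bits of [w], so beyond position [s] the
   sequence is trivially above [w]. *)
pose w' : Omega := fun j => nth (w j) x j.
have E : cd w' s = 2 ^ s + i.
  rewrite -Ex /cd; congr string_code; apply: (@eq_from_nth _ false).
    by rewrite size_mkseq.
  move=> j; rewrite size_mkseq => ltj; rewrite nth_mkseq // /w'.
  by apply: set_nth_default; rewrite sx.
rewrite -E -implybE; apply/implyP => /code_le_cd le; apply: Hs => j.
have [/le //|lej] := ltnP j s.
by rewrite /w' nth_default // sx.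
Qed.

Lemma tr_wlist (H : nat -> nat -> nat) : tr2 H -> tr2 (fun m => wlist (H m)).
Proof.
move=> hH; rewrite /tr2 /wlist /code_le /cov; cbv zeta.
repeat lazymatch goal with
| |- total_recursive (fun x => H _ _) => apply: (tr_comp2 hH)
| |- total_recursive (fun x => iter _ half _) =>
    apply: (@tr_iter _ _ (fun _ => half))
| _ => tr_step
end.
Qed.

(** Passes from packed arguments to an argument list: a lower semicomputation receives an index and
    the three numbers of [rat_code]. *)
Lemma tr4_program (h : nat -> nat -> nat -> nat -> nat) : tr4 h ->
  exists c, forall x y z t, receval c [:: x; y; z; t] (h x y z t).
Proof.
move=> [c Hc]; exists (RComp c [:: RComp rpair [:: RProj 0; RComp rpair
  [:: RProj 1; RComp rpair [:: RProj 2; RProj 3]]]]) => x y z t.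
apply: (@receval_comp1 _ _ _ (npair x (npair y (npair z t)))).
  apply: receval_comp2; [exact: EProj| |exact: receval_pair].
  apply: receval_comp2; [exact: EProj| |exact: receval_pair].
  apply: receval_comp2; [exact: EProj|exact: EProj|exact: receval_pair].
by have := Hc (npair x (npair y (npair z t))); rewrite !(nhdK, ntlK).
Qed.

Local Open Scope ring_scope.

(** The integral of a non-negative function is a supremum over the simple functions below it, hence
    monotone on all functions. This allows comparisons with [weighted_sup] and with the test [r]
    directly. *)
Lemma ge0_le_integralT d (T : measurableType d) (R : realType)
    (mu : {measure set T -> \bar R}) (f g : T -> \bar R) :
  (forall x, 0 <= f x)%E -> (forall x, f x <= g x)%E ->
  (\int[mu]_x f x <= \int[mu]_x g x)%E.
Proof.
move=> f0 fg; have g0 x : (0 <= g x)%E by exact: le_trans (fg x).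
rewrite !ge0_integralTE //.
apply: le_ereal_sup => _ [h hf <-]; exists h => // x.
exact: le_trans (hf x) (fg x).
Qed.

(** * Sparseness tests *)

Section WeightedSup.
Context (R : realType) (W : nat -> set Omega).

Definition weighted_sup (w : Omega) : \bar R :=
  ereal_sup [set (m%:R * \1_(W m) w)%:E | m in [set: nat]].

Lemma weighted_sup_gt (x : \bar R) w :
  (x < weighted_sup w)%E <-> exists m, (x < (m%:R * \1_(W m) w)%:E)%E.
Proof.
split=> [/ereal_sup_gt[_ [m _ <-]]|[m lt]]; first by exists m.
by apply: (lt_le_trans lt); apply: ereal_sup_ubound; exists m.
Qed.

Lemma weighted_sup_ge0 w : (0 <= weighted_sup w)%E.
Proof. by apply: ereal_sup_ubound; exists 0%N => //; rewrite mul0r. Qed.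

Lemma weighted_sup_lt_pinfty w : (weighted_sup w < +oo)%E -> exists m, ~ W m w.
Proof.
move=> lt; apply: contrapT => /forallNP nW.
have Wm m : W m w by exact: contrapT.
move: lt; apply/negP; rewrite -leNgt leye_eq; apply/eqP/eq_infty => t.
pose N := Num.bound `|t|.
apply: (@le_trans _ _ (N%:R * \1_(W N) w)%:E).
  rewrite lee_fin indicE mem_set // mulr1; apply: le_trans (ler_norm _) _.
  exact/ltW/archi_boundP.
by apply: ereal_sup_ubound; exists N.
Qed.

(** The supremum is at most the sum of its terms, and m * 4^-m <= 2^-(m+1) because 2m <= 2^m. This
    is what the exponent [2 * m] is chosen for. *)
Lemma integral_weighted_sup (B : probability Omega R) :
  (forall m, measurable (W m)) ->
  (forall m, B (W m) <= (2 ^- (2 * m)%N)%:E)%E ->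
  (\int[B]_w weighted_sup w <= 1)%E.
Proof.
move=> mW BW.
have term0 m w : (0 <= (m%:R * \1_(W m) w : R)%:E)%E by rewrite lee_fin mulr_ge0.
have mterm m : measurable_fun [set: Omega]
    (fun w => (m%:R * \1_(W m) w)%:E : \bar R).
  by apply/measurable_EFinP; apply: measurable_funM => //.
apply: le_trans (_ : _ <=
    \int[B]_w (\sum_(0 <= m <oo) (m%:R * \1_(W m) w)%:E))%E _.
  apply: ge0_le_integralT => [|w]; first exact: weighted_sup_ge0.
  apply: ub_ereal_sup => _ [m _ <-].
  rewrite (@nneseriesD1 _ _ m xpredT) //.
  by rewrite leeDl // nneseries_ge0.
rewrite integral_nneseries //.
apply: le_trans (epsilon_trick0 xpredT (@ler01 R)).
apply: lee_nneseries => [m _ _|m _]; first by apply: integral_ge0.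
under eq_integral do rewrite EFinM.
rewrite ge0_integralZl //; last by apply/measurable_EFinP.
rewrite integral_indic // setIT.
apply: (@le_trans _ _ (m%:R%:E * (2 ^- (2 * m)%N)%:E)%E).
  by apply: lee_wpmul2l; [rewrite lee_fin|exact: BW].
rewrite -EFinM lee_fin natrX exprS mul2n -addnn exprD.
have m2 : m%:R * 2 <= 2 ^+ m :> R.
  rewrite -natrM -natrX ler_nat; elim: (m) => // n IH.
  by rewrite expnS; have := ltn_expl n (ltnSn 1); lia.
have e0 : 0 < 2 ^+ m :> R by rewrite exprn_gt0.
rewrite ler_pdivlMr ?mulr_gt0 // mulrAC ler_pdivrMr ?mulr_gt0 //.
by rewrite mul1r mulrA ler_pM2r.
Qed.

End WeightedSup.

Lemma lower_semicomputable_weighted_sup (R : realType) (h : nat -> nat -> nat) :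
  tr2 h -> lower_semicomputable (@weighted_sup R (fun m => covered (h m))).
Proof.
move=> hh.
(* A negative rational lies below every value, and 1 codes the empty string, whose interval is the
   whole space. Otherwise q < m is tested by cross-multiplication, and a failed test outputs 0,
   which codes no string. *)
pose g k s u v := if s == 0%N then
    if (u < nhd k * v)%N then h (nhd k) (ntl k) else 0%N
  else 1%N.
have /tr4_program[c Hc] : tr4 g.
  rewrite /g; repeat lazymatch goal with
  | |- total_recursive (fun x => h _ _) => apply: (tr_comp2 hh)
  | _ => tr_step
  end.
have qE (q : rat) x : 0 <= q ->
    ((ratr q)%:E < (x%:R : R)%:E)%E = (`|numq q| < x * `|denq q|)%N.
  move=> q0; have dE : (denq q)%:~R = `|denq q|%:R :> R.
    by rewrite pmulrn absz_denq.
  have nE : (numq q)%:~R = `|numq q|%:R :> R.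
    by rewrite [in RHS]pmulrn gez0_abs // numq_ge0.
  rewrite lte_fin /ratr dE nE ltr_pdivrMr -?natrM ?ltr_nat //.
  by rewrite ltr0n absz_gt0.
exists c => q; apply/seteqP; split=> w /=.
  move=> /weighted_sup_gt[m lt]; apply/enum_openE.
  rewrite /rat_code; have [q0|q0] := ltP q 0.
    by exists 0%N, 0%N; exact: Hc.
  have [[k [s E]]|nW] := pselect (covered (h m) w); last first.
    by move: lt; rewrite indicE memNset // mulr0 (qE _ 0%N) // mul0n.
  exists (npair m k), s; have := Hc (npair m k) 0%N `|numq q|%N `|denq q|%N.
  move: lt; rewrite indicE mem_set; last by exists k, s.
  by rewrite mulr1 qE // /g !(nhdK, ntlK) /= E => ->.
move=> /enum_openE[k [s]]; rewrite /rat_code; have [q0|q0] := ltP q 0.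
  move=> _; apply: lt_le_trans (@weighted_sup_ge0 _ _ _).
  by rewrite lte_fin ltrq0.
move=> /(receval_inj (Hc _ _ _ _)); rewrite /g /=; case: ifP => [lt E|_ E].
  apply/weighted_sup_gt; exists (nhd k).
  by rewrite indicE mem_set ?mulr1 ?qE //; exists (ntl k), s.
by have := cd_gt0 w s; rewrite -E.
Qed.

(** * Randomness and the finiteness criterion *)

Lemma measurable_enum_open c v : measurable (enum_open c v).
Proof.
rewrite (_ : enum_open c v = \bigcup_s
    [set w | `[< exists k, receval c (k :: v) (cd w s) >]]).
  apply: bigcupT_measurable => s.
  exact: (@measurable_cdP s (fun y => `[< exists k, receval c (k :: v) y >])).
apply/seteqP; split=> w.
  by move=> /enum_openE[k [s H]]; exists s => //; apply/asboolP; exists k.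
by move=> [s _ /asboolP[k H]]; apply/enum_openE; exists k, s.
Qed.

Lemma sparse_lt_pinfty (R : realType) (B : probability Omega R)
    (r : Omega -> \bar R) w :
  sparseness_test B r -> sparse B w -> (r w < +oo)%E.
Proof.
move=> [r0 rmon [c rc] rint] [w' le rnd]; apply: le_lt_trans (rmon _ _ le) _.
rewrite ltey; apply/eqP => rw'.
pose U n : set Omega := [set x | ((2 ^+ n)%:E < r x)%E].
apply: (rnd U); last by move=> n _; rewrite /U /= rw' ltry.
have UE n : U n = enum_open c [:: 0; 2 ^ n; 1]%N.
  have := rc (2 ^ n)%N%:Q; rewrite ratr_int -pmulrn natrX => Ern.
  rewrite /U Ern /rat_code numq_int denq_int ltNge ler0z /=.
  by [].
split.
  have [c2 Hc2] : total_recursive (fun n => 2 ^ n)%N by tr.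
  have [c1 Hc1] : total_recursive (fun=> 1)%N by tr.
  (* From [[:: k; n]] these programs produce the index [k] followed by the rational code of 2^n, the
     input on which [c] lists [U n]. *)
  pose gs := [:: RProj 0; RZero; RComp c2 [:: RProj 1]; RComp c1 [:: RProj 1]].
  have Hgs k n i : (i < 4)%N -> receval (nth RZero gs i) [:: k; n]
      (nth 0 [:: k; 0; 2 ^ n; 1] i)%N.
    case: i => [|[|[|[|//]]]] _ /=.
    - exact: EProj.
    - exact: EZero.
    - by apply: receval_comp1; [exact: EProj|exact: Hc2].
    - by apply: receval_comp1; [exact: EProj|exact: Hc1].
  exists (RComp c gs) => n; rewrite UE; apply/seteqP; split=> x.
    move=> /enum_openE[k [s H]]; apply/enum_openE; exists k, s.
    by apply: EComp H => // i; exact: Hgs.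
  move=> /enum_openE[k [s /receval_compE[ws [szw Hws H]]]].
  apply/enum_openE; exists k, s; suff <- : ws = [:: k; 0; 2 ^ n; 1]%N by [].
  apply: (@eq_from_nth _ 0%N); first by rewrite szw.
  by move=> i; rewrite szw => lti; apply: receval_inj (Hws _ lti) (Hgs _ _ _ lti).
move=> n; have mU : measurable (U n) by rewrite UE; exact: measurable_enum_open.
have e0 : 0 < 2 ^+ n :> R by rewrite exprn_gt0.
have : (\int[B]_x ((2 ^+ n)%:E * (\1_(U n) x)%:E) <= 1)%E.
  apply: le_trans rint; apply: ge0_le_integralT => x.
    by rewrite mule_ge0 ?lee_fin // ltW.
  rewrite indicE; case: (boolP (x \in U n)) => [|_]; last by rewrite mule0.
  by rewrite inE mule1 => /ltW.
rewrite ge0_integralZl //; last by apply/measurable_EFinP.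
rewrite integral_indic // setIT => le1.
by move: le1; rewrite -lee_pdivlMl // mule1.
Qed.

Theorem theorem16 (R : realType) (p : R) (hp0 : 0 <= p) (hp1 : p <= 1)
    (hp : computable_real p)
    (B : probability Omega R) (hB : is_bernoulli_measure p B)
    (r : Omega -> \bar R) (hr : universal_sparseness_test B r) (w : Omega) :
  sparse B w <-> (r w < +oo)%E.
Proof.
have [rtest runiv] := hr; split; first exact: sparse_lt_pinfty.
move=> rw; have [a [d [ha hd d0 ad]]] := computable_real_approx hp0 hp1 hp.
pose h m := wlist (vlist a d (2 * m)%N).
have hW m : covered (h m) `<=` covered (vlist a d (2 * m)%N).
  (* Every sequence is one of its own majorants. *)
  by rewrite covered_wlist => x; apply => i.
have htr : tr2 h.
  rewrite /tr2 /h.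
  apply: (tr_comp2 (tr_wlist (tr_vlist ha hd))); tr.
have [|C C0 fC] := runiv (@weighted_sup R (fun m => covered (h m))).
  split.
  - exact: weighted_sup_ge0.
  - move=> x y le; apply: ub_ereal_sup => _ [m _ <-].
    apply: ereal_sup_ge; exists (m%:R * \1_(covered (h m)) y)%:E; first by exists m.
    rewrite lee_fin ler_wpM2l // !indicE ler_nat.
    have [Wx|//] := boolP (x \in _); rewrite mem_set //.
    move: Wx; rewrite inE !covered_wlist /= => Wx y' le'; apply: Wx => i.
    exact: leq_trans (le i) (le' i).
  - exact: lower_semicomputable_weighted_sup.
  - apply: integral_weighted_sup => m; first exact: measurable_covered.
    apply: le_trans (bernoulli_vlist hB hp0 hp1 d0 ad (2 * m)%N).
    by apply: le_measure (hW m); rewrite inE; exact: measurable_covered.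
have [|m] := @weighted_sup_lt_pinfty R (fun m => covered (h m)) w.
  by apply: le_lt_trans (fC w) _; rewrite lte_mul_pinfty // ?lee_fin ?ltW.
rewrite /h covered_wlist /= => /existsNP[w' /not_implyP[le nV]].
exists w' => // U testU Uw'; apply: nV.
exact: (@martin_lof_test_vlist _ _ _ hB _ _ d0 ad U _ testU _ Uw').
Qed.
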